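(* Let $\phi : (M^2 ,g) \to N^3 (c)$ be a proper-biharmonic Riemannian immersion with constant mean curvature in a three-dimensional real space form $N^3(c)$. Then it is umbilical.
   Context: All objects are smooth; $(M^2,g)$ is a two-dimensional Riemannian manifold, and $N^3(c)$ is a three-dimensional Riemannian manifold of constant sectional curvature $c$. The curvature convention is $R(X,Y)=[\nabla_X,\nabla_Y]-\nabla_{[X,Y]}$. For a smooth map $\phi:M\to N$, $\tau(\phi)=\mathrm{trace}\,\nabla d\phi$ is the tension field, and $\phi$ is harmonic if $\tau(\phi)=0$. The map $\phi$ is biharmonic if $\mathrm{trace}(\nabla^\phi)^2\tau(\phi)-\mathrm{trace}\,R^N(d\phi(\cdot),\tau(\phi))d\phi(\cdot)=0$ (with $\nabla^\phi$ the pull-back connection on $\phi^{-1}TN$), and proper-biharmonic if it is biharmonic and not harmonic. A Riemannian immersion is an isometric immersion; $B$ is its second fundamental form and $H=\frac12\mathrm{trace}\,B$ its mean curvature vector field. Constant mean curvature means that $|H|$ is constant. The immersion is umbilical if $B(X,Y)=g(X,Y)H$ for all $X,Y$ at every point. *)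

(* Defs.v *)
(* The reals are an arbitrary R : realType.  Manifolds are given by atlases;  *)
(* tangent vectors, metrics and connections are handled through their        *)
(* components in charts, tangent vectors being row vectors of components.    *)
From mathcomp Require Export all_boot all_order all_algebra.
From mathcomp Require Export all_classical all_reals all_analysis.

Set Implicit Arguments.
Unset Strict Implicit.
Unset Printing Implicit Defensive.

Export numFieldNormedType.Exports.
Import Order.TTheory GRing.Theory Num.Theory.
Local Open Scope classical_set_scope.
Local Open Scope ring_scope.

Section Smoothness.
Context {R : realType} {V W : normedModType R}.

(* C^k on U (meant for U open): Frechet differentiable at each point of U,   *)
(* with all directional derivatives of class C^(k-1).  For finite-           *)
(* dimensional V this is the usual notion.                                   *)
Fixpoint Ck_on (k : nat) (U : set V) (f : V -> W) : Prop :=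
  match k with
  | 0 => forall x, U x -> {for x, continuous f}
  | k'.+1 => (forall x, U x -> differentiable f x) /\
             (forall v, Ck_on k' U (fun x => 'D_v f x))
  end.

Definition smooth_on (U : set V) (f : V -> W) : Prop := forall k, Ck_on k U f.

End Smoothness.

Definition basis_vec (R : realType) (n : nat) (i : 'I_n) : 'rV[R]_n :=
  delta_mx 0 i.

(* In this section G is the component matrix of a metric in a chart of an    *)
(* n-dimensional manifold, as a function of the coordinates.                 *)
Section MetricInCoordinates.
Context {R : realType} {n : nat}.
Implicit Types (G : 'rV[R]_n -> 'M[R]_n) (x u v w : 'rV[R]_n).
Implicit Types X Y Z : 'rV[R]_n -> 'rV[R]_n.

Definition inner G x u v : R := (u *m G x *m v^T) 0 0.

Definition mtrace G x {W : lmodType R} (b : 'rV[R]_n -> 'rV[R]_n -> W) : W :=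
  \sum_(i < n) \sum_(j < n)
    invmx (G x) i j *: b (basis_vec R i) (basis_vec R j).

(* Gamma^k_ij of the Levi-Civita connection.                                 *)
Definition christoffel G x (k i j : 'I_n) : R :=
  2^-1 * \sum_(l < n) invmx (G x) k l *
    ('D_(basis_vec R i) (fun y => G y j l) x
     + 'D_(basis_vec R j) (fun y => G y i l) x
     - 'D_(basis_vec R l) (fun y => G y i j) x).

Definition Gamma G x u v : 'rV[R]_n :=
  \row_k \sum_(i < n) \sum_(j < n) christoffel G x k i j * u 0 i * v 0 j.

Definition nabla G X Y x : 'rV[R]_n :=
  'D_(X x) Y x + Gamma G x (X x) (Y x).

Definition lie_bracket X Y x : 'rV[R]_n := 'D_(X x) Y x - 'D_(Y x) X x.

Definition curvature G X Y Z x : 'rV[R]_n :=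
  nabla G X (nabla G Y Z) x - nabla G Y (nabla G X Z) x
  - nabla G (lie_bracket X Y) Z x.

(* The curvature is tensorial, so its value on tangent vectors may be        *)
(* computed with the extensions that are constant in the chart.              *)
Definition riem G x u v w : 'rV[R]_n :=
  curvature G (cst u) (cst v) (cst w) x.

Definition sectional_curvature G x u v : R :=
  inner G x (riem G x u v v) u /
  (inner G x u u * inner G x v v - inner G x u v ^+ 2).

End MetricInCoordinates.

(* Here f is the expression in charts of a map into a manifold with metric   *)
(* H, defined on a manifold with metric G.                                   *)
Section MapInCoordinates.
Context {R : realType} {m n : nat}.
Variables (G : 'rV[R]_m -> 'M[R]_m) (H : 'rV[R]_n -> 'M[R]_n).
Variable f : 'rV[R]_m -> 'rV[R]_n.
Implicit Types (x u v : 'rV[R]_m) (X Y : 'rV[R]_m -> 'rV[R]_m).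
Implicit Types V : 'rV[R]_m -> 'rV[R]_n.

Definition push X x : 'rV[R]_n := 'D_(X x) f x.

(* The pull-back connection; V is a section of f^-1 TN.                      *)
Definition pnabla X V x : 'rV[R]_n :=
  'D_(X x) V x + Gamma H (f x) (push X x) (V x).

(* As with riem, the tensorial expressions in X and Y below are evaluated    *)
(* on tangent vectors through extensions that are constant in the chart.     *)
Definition nabla_df X Y x : 'rV[R]_n :=
  pnabla X (push Y) x - push (nabla G X Y) x.

Definition tension x : 'rV[R]_n :=
  mtrace G x (fun u v => nabla_df (cst u) (cst v) x).

Definition pnabla2 X Y V x : 'rV[R]_n :=
  pnabla X (pnabla Y V) x - pnabla (nabla G X Y) V x.

Definition bitension x : 'rV[R]_n :=
  mtrace G x (fun u v => pnabla2 (cst u) (cst v) tension x)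
  - mtrace G x (fun u v => riem H (f x) ('D_u f x) (tension x) ('D_v f x)).

(* Component orthogonal to the image of the differential, when f is          *)
(* isometric: w - g^ij <w, df(e_i)> df(e_j).                                 *)
Definition normal_part x (w : 'rV[R]_n) : 'rV[R]_n :=
  w - mtrace G x (fun u v => inner H (f x) w ('D_u f x) *: 'D_v f x).

Definition second_form x u v : 'rV[R]_n :=
  normal_part x (pnabla (cst u) (push (cst v)) x).

Definition mean_curvature x : 'rV[R]_n :=
  m%:R^-1 *: mtrace G x (second_form x).

Definition mean_curvature_norm x : R :=
  Num.sqrt (inner H (f x) (mean_curvature x) (mean_curvature x)).

End MapInCoordinates.

Section Manifolds.
Context (R : realType).

(* coord i is only meaningful on dom i, and param i, its inverse, only on    *)
(* the image coord i @` dom i.                                               *)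
Record manifold (n : nat) := Manifold {
  points :> topologicalType;
  manifold_hausdorff : hausdorff_space points;
  manifold_second_countable : @second_countable points;
  chart : Type;
  dom : chart -> set points;
  coord : chart -> points -> 'rV[R]_n;
  param : chart -> 'rV[R]_n -> points;
  dom_open : forall i, open (dom i);
  dom_cover : forall p, exists i, dom i p;
  image_open : forall i, open (coord i @` dom i);
  coordK : forall i p, dom i p -> param i (coord i p) = p;
  coord_continuous : forall i, {within dom i, continuous (coord i)};
  param_continuous :
    forall i, {within coord i @` dom i, continuous (param i)};
  transition_smooth : forall i j,
    smooth_on (coord i @` (dom i `&` dom j)) (coord j \o param i)
}.

Record metric (n : nat) (M : manifold n) := Metric {
  gmx :> chart M -> 'rV[R]_n -> 'M[R]_n;
  gmx_smooth : forall i, smooth_on (coord i @` dom i) (gmx i);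
  gmx_sym : forall i p, dom i p -> (gmx i (coord i p))^T = gmx i (coord i p);
  gmx_pos : forall i p, dom i p -> forall u, u != 0 ->
    0 < inner (gmx i) (coord i p) u u;
  gmx_compatible : forall i j p, dom i p -> dom j p -> forall u v,
    inner (gmx i) (coord i p) u v =
    inner (gmx j) (coord j p)
      ('D_u (coord j \o param i) (coord i p))
      ('D_v (coord j \o param i) (coord i p))
}.

Definition constant_curvature (n : nat) (N : manifold n) (h : metric N)
    (c : R) : Prop :=
  forall (i : chart N) p, dom i p -> forall u v, free [:: u; v] ->
    sectional_curvature (h i) (coord i p) u v = c.

Section Maps.
Context (m n : nat) (M : manifold m) (N : manifold n).
Variables (g : metric M) (h : metric N) (phi : M -> N).

Definition local_rep (i : chart M) (j : chart N) : 'rV[R]_m -> 'rV[R]_n :=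
  coord j \o phi \o param i.

Definition smooth_map : Prop :=
  continuous phi /\
  forall i j, smooth_on (coord i @` (dom i `&` phi @^-1` dom j))
                (local_rep i j).

(* P holds at every point, in all charts of the two atlases around it and    *)
(* around its image.  The predicates used below do not depend on the charts. *)
Definition everywhere (P : chart M -> chart N -> 'rV[R]_m -> Prop) : Prop :=
  forall i j p, dom i p -> dom j (phi p) -> P i j (coord i p).

Definition riemannian_immersion : Prop :=
  [/\ smooth_map,
      everywhere (fun i j x => injective (fun u => 'D_u (local_rep i j) x))
    & everywhere (fun i j x => forall u v,
        inner (h j) (local_rep i j x)
          ('D_u (local_rep i j) x) ('D_v (local_rep i j) x)
        = inner (g i) x u v)].

Definition harmonic : Prop :=
  everywhere (fun i j x => tension (g i) (h j) (local_rep i j) x = 0).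

Definition biharmonic : Prop :=
  everywhere (fun i j x => bitension (g i) (h j) (local_rep i j) x = 0).

Definition proper_biharmonic : Prop := biharmonic /\ ~ harmonic.

Definition constant_mean_curvature : Prop :=
  exists k : R, everywhere (fun i j x =>
    mean_curvature_norm (g i) (h j) (local_rep i j) x = k).

Definition umbilical : Prop :=
  everywhere (fun i j x => forall u v,
    second_form (g i) (h j) (local_rep i j) x u v
    = inner (g i) x u v *: mean_curvature (g i) (h j) (local_rep i j) x).

End Maps.
End Manifolds.

(* Main.v *)
Require Import Defs.
From mathcomp Require Import ring lra.

(** Write T for the tension field of phi, which is twice the mean curvature
    vector field H. It is normal to the surface, and by hypothesis its square
    length t is constant. As phi is not harmonic somewhere, t > 0 everywhere,
    so T is a normal field without zeros and plays the role of the unit normal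
    throughout, up to the constant factor |T|. Let A be the shape operator with
    respect to T, so that the covariant derivative of T along w is the image of
    - A w. Then trace A = <T, T> = t.

    The normal component of the biharmonic equation gives trace (A^2) = 2 c t:
    since |T| is constant, the inner product of the rough Laplacian of T with T
    is minus the squared norm of the derivative of T, that is, - trace (A^2),
    and in a space form the curvature term contributes 2 c t
    ([inner_bitension_tension]). So the eigenvalues l and m of A are constants
    with l + m = t and l^2 + m^2 = 2 c t.

    If l = m the surface is umbilical. If l and m are distinct, the principal
    directions are parallel line fields, the surface is flat, and the Gauss
    equation c + l m / t = 0 yields t^2 = (l + m)^2 = 2 c t + 2 l m = 0, which is
    absurd ([distinct_principal_curvatures_absurd]). Flatness is obtained along
    the immersion, with no intrinsic curvature and no orthonormal frame: the
    forms F w = D_w T + m df(w) and N w = D_w T + l df(w) take values in the two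
    principal lines of the ambient bundle and are closed by the Codazzi
    equation; the symmetries of <D_w F a, N a'> make it vanish
    ([DF_N_orthogonal]), and its derivative is the Gauss equation.

    This core argument ([shape_half_trace_of_traces]) uses four facts on the
    pull-back connection: it is metric, it is torsion free, its curvature is that
    of the target, and the Hessian of an isometric immersion is normal. In charts
    they follow from the Koszul formula for the Christoffel symbols
    ([inner_Gamma]), the product rule [derive_bilin] and the symmetry of second
    derivatives [derive_swap]. That constant sectional curvature determines the
    curvature tensor is [riem_constant_curvature]. *)

Set Implicit Arguments.
Unset Strict Implicit.
Unset Printing Implicit Defensive.
Import Order.TTheory GRing.Theory Num.Theory.
Local Open Scope classical_set_scope.
Local Open Scope ring_scope.

(** * Inner products, orthogonal bases and metric traces *)

Section Bilin.
Context {R : realType} {n : nat} {W : lmodType R}.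
Implicit Types (b : 'rV[R]_n -> 'rV[R]_n -> W).

Definition bilin b := (forall u, linear (b u)) /\ (forall v, linear (b^~ v)).

Lemma bilinDl b : bilin b -> forall u u' v, b (u + u') v = b u v + b u' v.
Proof. by move=> [_ bl] u u' v; have := bl v 1 u u'; rewrite !scale1r. Qed.

Lemma bilinDr b : bilin b -> forall u v v', b u (v + v') = b u v + b u v'.
Proof. by move=> [br _] u v v'; have := br u 1 v v'; rewrite !scale1r. Qed.

Lemma bilin0l b : bilin b -> forall v, b 0 v = 0.
Proof. by move=> bb v; apply: (@addrI _ (b 0 v)); rewrite -bilinDl // !addr0. Qed.

Lemma bilin0r b : bilin b -> forall u, b u 0 = 0.
Proof. by move=> bb v; apply: (@addrI _ (b v 0)); rewrite -bilinDr // !addr0. Qed.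

Lemma bilinZl b : bilin b -> forall a u v, b (a *: u) v = a *: b u v.
Proof.
by move=> bb a u v; have := bb.2 v a u 0; rewrite !addr0 bilin0l // addr0.
Qed.

Lemma bilinZr b : bilin b -> forall a u v, b u (a *: v) = a *: b u v.
Proof.
by move=> bb a u v; have := bb.1 u a v 0; rewrite !addr0 bilin0r // addr0.
Qed.

Lemma bilinNl b : bilin b -> forall u v, b (- u) v = - b u v.
Proof. by move=> bb u v; rewrite -[- u]scaleN1r (bilinZl bb) scaleN1r. Qed.

Lemma bilinNr b : bilin b -> forall u v, b u (- v) = - b u v.
Proof. by move=> bb u v; rewrite -[- v]scaleN1r (bilinZr bb) scaleN1r. Qed.

Lemma bilin_suml b : bilin b -> forall I (r : seq I) (F : I -> 'rV[R]_n) v,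
  b (\sum_(i <- r) F i) v = \sum_(i <- r) b (F i) v.
Proof.
move=> bb I r F v; elim: r => [|i r IH]; first by rewrite !big_nil bilin0l.
by rewrite !big_cons bilinDl // IH.
Qed.

Lemma bilin_sumr b : bilin b -> forall I (r : seq I) (F : I -> 'rV[R]_n) u,
  b u (\sum_(i <- r) F i) = \sum_(i <- r) b u (F i).
Proof.
move=> bb I r F v; elim: r => [|i r IH]; first by rewrite !big_nil bilin0r.
by rewrite !big_cons bilinDr // IH.
Qed.

Lemma bilinE b : bilin b -> forall u v, b u v =
  \sum_i \sum_j (u 0 i * v 0 j) *: b (basis_vec R i) (basis_vec R j).
Proof.
move=> bb u v; rewrite [u in LHS]row_sum_delta bilin_suml //.
apply: eq_bigr => i _; rewrite [v in LHS]row_sum_delta bilin_sumr //.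
by apply: eq_bigr => j _; rewrite bilinZl // bilinZr // scalerA.
Qed.

End Bilin.

Section Trace.
Context {R : realType} {n : nat} {W : lmodType R}.
Variables (G : 'rV[R]_n -> 'M[R]_n) (x : 'rV[R]_n).
Implicit Types (b : 'rV[R]_n -> 'rV[R]_n -> W).

Lemma eq_mtrace b b' : (forall u v, b u v = b' u v) ->
  mtrace G x b = mtrace G x b'.
Proof. by move=> e; apply: eq_bigr => i _; apply: eq_bigr => j _; rewrite e. Qed.

Lemma mtrace_map (W' : lmodType R) (F : W -> W') b : linear F ->
  F (mtrace G x b) = mtrace G x (fun u v => F (b u v)).
Proof.
move=> linF.
have F0 : F 0 = 0.
  have := linF 1 0 0; rewrite !scale1r addr0 => F0.
  by apply: (@addrI _ (F 0)); rewrite addr0 -F0.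
have FD u v : F (u + v) = F u + F v by have := linF 1 u v; rewrite !scale1r.
have FZ a u : F (a *: u) = a *: F u by have := linF a u 0; rewrite F0 !addr0.
have Fsum I (r : seq I) h : F (\sum_(i <- r) h i) = \sum_(i <- r) F (h i).
  by elim: r => [|i r IH]; rewrite ?big_nil // !big_cons FD IH.
rewrite /mtrace Fsum; apply: eq_bigr => i _.
by rewrite Fsum; apply: eq_bigr => j _; rewrite FZ.
Qed.

End Trace.

Section InnerProduct.
Context {R : realType} {n : nat}.
Variables (G : 'rV[R]_n -> 'M[R]_n) (x : 'rV[R]_n).
Local Notation ip := (inner G x).
Implicit Types u v w z : 'rV[R]_n.

Lemma inner_bilin : bilin (inner G x : _ -> _ -> R^o).
Proof.
split=> [u a v v'|v a u u']; rewrite /inner.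
  by rewrite linearP /= mulmxDr -scalemxAr !mxE.
by rewrite !mulmxDl -!scalemxAl !mxE.
Qed.

Lemma innerDl u u' v : ip (u + u') v = ip u v + ip u' v.
Proof. exact: bilinDl inner_bilin _ _ _. Qed.
Lemma innerDr u v v' : ip u (v + v') = ip u v + ip u v'.
Proof. exact: bilinDr inner_bilin _ _ _. Qed.
Lemma innerZl a u v : ip (a *: u) v = a * ip u v.
Proof. exact: bilinZl inner_bilin _ _ _. Qed.
Lemma innerZr a u v : ip u (a *: v) = a * ip u v.
Proof. exact: bilinZr inner_bilin _ _ _. Qed.
Lemma innerNl u v : ip (- u) v = - ip u v.
Proof. exact: bilinNl inner_bilin _ _. Qed.
Lemma innerNr u v : ip u (- v) = - ip u v.
Proof. exact: bilinNr inner_bilin _ _. Qed.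
Lemma inner0l v : ip 0 v = 0.
Proof. exact: bilin0l inner_bilin _. Qed.
Lemma inner_suml I (r : seq I) (F : I -> 'rV[R]_n) v :
  ip (\sum_(i <- r) F i) v = \sum_(i <- r) ip (F i) v.
Proof. exact: (bilin_suml inner_bilin). Qed.

Lemma inner_basis i j : ip (basis_vec R i) (basis_vec R j) = G x i j.
Proof.
by rewrite /inner /basis_vec -rowE trmx_delta -colE !mxE.
Qed.

Hypothesis Gsym : (G x)^T = G x.

Lemma innerC u v : ip u v = ip v u.
Proof.
rewrite /inner; set A := u *m _ *m _.
have -> : A 0 0 = A^T 0 0 by rewrite [RHS]mxE.
by rewrite /A !trmx_mul trmxK Gsym mulmxA.
Qed.

Hypothesis Gpos : forall u, u != 0 -> 0 < ip u u.

Lemma inner_ge0 u : 0 <= ip u u.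
Proof. by have [->|/Gpos/ltW//] := eqVneq u 0; rewrite inner0l. Qed.

Lemma posdef_unitmx : G x \in unitmx.
Proof.
rewrite -row_free_unit -kermx_eq0; apply/eqP/row_matrixP => i; rewrite row0.
apply/eqP/negPn/negP => /Gpos.
have /sub_kermxP uG := row_sub i (kermx (G x)).
by rewrite /inner uG mul0mx mxE ltxx.
Qed.

Section OrthogonalBasis.
Variable P : 'I_n -> 'rV[R]_n.
Hypothesis Porth : forall i j, i != j -> ip (P i) (P j) = 0.
Hypothesis P0 : forall i, P i != 0.

Let M := \matrix_i P i.
Let d := \row_i ip (P i) (P i).

Let d_neq0 i : ip (P i) (P i) != 0. Proof. by rewrite gt_eqF // Gpos. Qed.

Let MGM : M *m G x *m M^T = diag_mx d.
Proof.
apply/matrixP => i j.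
have -> : (M *m G x *m M^T) i j = ip (P i) (P j).
  rewrite /inner -[P i](rowK P) -[P j](rowK P) -/M !mxE.
  by apply: eq_bigr => k _; rewrite !mxE; congr (_ * _);
     apply: eq_bigr => l _; rewrite !mxE.
by rewrite !mxE; case: eqVneq => [->|/Porth->]; rewrite ?mulr1n ?mulr0n.
Qed.

Let Mu : M \in unitmx.
Proof.
have : diag_mx d \in unitmx.
  rewrite unitmxE det_diag unitfE; apply/prodf_neq0 => i _; rewrite mxE.
  exact: d_neq0.
by rewrite -MGM !unitmx_mul => /andP[/andP[]].
Qed.

Lemma orthogonal_basis_eq0 z : (forall i, ip z (P i) = 0) -> z = 0.
Proof.
move=> zP.
have : z *m (G x *m M^T) = 0.
  apply/rowP => i; rewrite mulmxA [LHS]mxE [RHS]mxE -[RHS](zP i) /inner !mxE.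
  by apply: eq_bigr => k _; rewrite !mxE.
move/(congr1 (mulmxr (invmx (G x *m M^T)))) => /=.
by rewrite mulmxK ?mul0mx // unitmx_mul posdef_unitmx unitmx_tr.
Qed.

Lemma orthogonal_basis_expansion z :
  z = \sum_i (ip z (P i) / ip (P i) (P i)) *: P i.
Proof.
apply/subr0_eq/orthogonal_basis_eq0 => i.
rewrite innerDl innerNl inner_suml (bigD1 i) //= big1 => [|j ji].
  by rewrite innerZl divfK // addr0 subrr.
by rewrite innerZl (Porth ji) mulr0.
Qed.

(** The definitions take traces in the coordinate basis, the geometry takes them
    in a frame adapted to the surface. With M the matrix whose rows are the P i,
    orthogonality says that M G M^T is a diagonal matrix D, hence G^-1 is
    M^T D^-1 M. *)
Lemma mtrace_orthogonal (W : lmodType R) (b : 'rV[R]_n -> 'rV[R]_n -> W) :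
  bilin b -> mtrace G x b = \sum_i (ip (P i) (P i))^-1 *: b (P i) (P i).
Proof.
move=> bb.
pose D := diag_mx (\row_k (ip (P k) (P k))^-1).
have DdE : D *m diag_mx d = 1%:M.
  rewrite /D mulmx_diag; apply/matrixP => i j; rewrite !mxE.
  by case: eqVneq => // _; rewrite mulVf.
have GD : (M^T *m D *m M) *m G x = 1%:M.
  have GMD : M *m G x *m (M^T *m D) = 1%:M.
    by rewrite mulmxA MGM; exact: mulmx1C.
  by apply: mulmx1C; rewrite -!mulmxA in GMD; rewrite !mulmxA -(mulmx1C GMD) !mulmxA.
have invE i j : invmx (G x) i j = \sum_k (ip (P k) (P k))^-1 * (P k 0 i * P k 0 j).
  have -> : invmx (G x) = M^T *m D *m M.
    by rewrite -[RHS](mulmxK posdef_unitmx) GD mul1mx.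
  rewrite mxE; apply: eq_bigr => k _; rewrite mul_mx_diag !mxE.
  by rewrite mulrAC mulrC.
rewrite /mtrace.
under eq_bigr do under eq_bigr do rewrite invE scaler_suml.
under [RHS]eq_bigr do rewrite (bilinE bb) scaler_sumr.
rewrite [RHS]exchange_big; apply: eq_bigr => i _ /=.
rewrite exchange_big; apply: eq_bigr => k _ /=.
by rewrite scaler_sumr; apply: eq_bigr => j _; rewrite scalerA.
Qed.

End OrthogonalBasis.
End InnerProduct.

(** * Smooth functions on an open set *)

Section LocalCalculus.
Context {R : realType} {V W : normedModType R}.
Implicit Types (f g : V -> W) (U : set V) (x v : V).

(** Two functions that agree near x differ by a function that vanishes near x, so
    this case carries the locality of differentiability. *)
Lemma differentiable_near0 f x : (\near x, f x = 0) -> differentiable f x.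
Proof.
move=> f0.
have e : f \o shift x = cst (f x) + (\0 : {linear V -> W}) +o_ 0 id.
  apply/eqaddoP => _ /posnumP[eps].
  have f0' : \forall y \near (0 : V), f (y + x) = 0.
    by move: f0; rewrite (near_shift 0)/= subr0.
  near=> y.
  have fy : f (y + x) = 0 by near: y.
  by rewrite !fctE/= fy (nbhs_singleton f0) !addr0 subr0 normr0 mulr_ge0.
apply/diff_locallyP.
have h := @diff_unique R V W f \0 x (@cst_continuous _ _ _) e.
by split; rewrite h //; exact: cst_continuous.
Unshelve. all: by end_near. Qed.

Lemma near_of_open U x (P : V -> Prop) : open U -> U x ->
  (forall y, U y -> P y) -> \near x, P x.
Proof.
by move=> oU Ux UP; apply: filterS (open_nbhs_nbhs (conj oU Ux)) => y /UP.
Qed.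

Lemma differentiable_ext U f g x : open U -> U x ->
  (forall y, U y -> f y = g y) -> differentiable f x -> differentiable g x.
Proof.
move=> oU Ux fg df.
have -> : g = f + (g - f) by rewrite addrC subrK.
apply: differentiableD => //; apply: differentiable_near0.
by apply: near_of_open oU Ux _ => y Uy; rewrite !fctE fg // subrr.
Qed.

Lemma derive_ext U f g x : open U -> U x ->
  (forall y, U y -> f y = g y) -> forall v, 'D_v f x = 'D_v g x.
Proof. by move=> oU Ux fg v; apply: near_eq_derive; exact: near_of_open fg. Qed.

Lemma derive_dirD f x u v : differentiable f x ->
  'D_(u + v) f x = 'D_u f x + 'D_v f x.
Proof. by move=> df; rewrite !deriveE // linearD. Qed.

Lemma derive_dirZ f x (a : R) v : differentiable f x ->
  'D_(a *: v) f x = a *: 'D_v f x.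
Proof. by move=> df; rewrite !deriveE // linearZ. Qed.

Lemma derive_linear (k : R) f g x v :
  differentiable f x -> differentiable g x ->
  'D_v (fun y => k *: f y + g y) x = k *: 'D_v f x + 'D_v g x.
Proof.
move=> df dg.
have dkf : derivable (k *: f) x v by apply/derivableZ/diff_derivable.
exact: etrans (deriveD dkf (diff_derivable dg))
  (congr1 (+%R^~ _) (deriveZ k (diff_derivable df))).
Qed.

End LocalCalculus.

Lemma row_basis_sum (R : realType) n (u : 'rV[R]_n) :
  u = \sum_i u 0 i *: basis_vec R i.
Proof. exact: row_sum_delta. Qed.

Section Entries.
Context {R : realType} {V : normedModType R} {m n : nat}.
Implicit Types (F : V -> 'M[R]_(m, n)).

Lemma differentiable_entry F x i j :
  differentiable F x -> differentiable (fun y => F y i j) x.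
Proof.
move=> dF; apply: (@differentiable_comp _ _ _ _ F (fun N => N i j)) => //.
exact: differentiable_coord.
Qed.

Lemma differentiable_entries F x :
  (forall i j, differentiable (fun y => F y i j) x) -> differentiable F x.
Proof.
move=> dF.
have -> : F = \sum_i \sum_j (fun y => F y i j *: delta_mx i j).
  apply/funext => y; rewrite fct_sumE [LHS]matrix_sum_delta.
  by apply: eq_bigr => i _; rewrite fct_sumE.
apply: differentiable_sum => i; apply: differentiable_sum => j.
exact: differentiableZl.
Qed.

Lemma derive_entry F x v i j : differentiable F x ->
  'D_v F x i j = 'D_v (fun y => F y i j) x.
Proof. by move=> dF; rewrite derive_mx ?mxE //; exact: diff_derivable. Qed.

End Entries.

Section SmoothOn.
Context {R : realType} {V W : normedModType R}.
Implicit Types (f g : V -> W) (U : set V) (x v : V).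

Lemma Ck_on_ext k U f g : open U -> (forall x, U x -> f x = g x) ->
  Ck_on k U f -> Ck_on k U g.
Proof.
move=> oU; elim: k f g => [|k IH] f g fg /=.
  move=> fc x Ux; suff : g @ x --> g x by [].
  rewrite -(fg x Ux); apply: cvg_trans (fc x Ux); apply: near_eq_cvg.
  by apply: near_of_open oU Ux _ => y Uy; rewrite fg.
move=> [df ckf]; split=> [x Ux|v]; first exact: differentiable_ext fg (df x Ux).
by apply: IH (ckf v) => x Ux; exact: (derive_ext oU Ux fg).
Qed.

Lemma smooth_on_ext U f g : open U -> (forall x, U x -> f x = g x) ->
  smooth_on U f -> smooth_on U g.
Proof. by move=> oU fg sf k; exact: Ck_on_ext (sf k). Qed.

Lemma smooth_differentiable U f x : smooth_on U f -> U x -> differentiable f x.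
Proof. by move=> /(_ 1%N) [+ _]; apply. Qed.

Lemma smooth_derive U f v : smooth_on U f -> smooth_on U (fun x => 'D_v f x).
Proof. by move=> sf k; have [_] := sf k.+1; apply. Qed.

Lemma smooth_cst U (a : W) : smooth_on U (fun=> a).
Proof.
move=> k; elim: k a => [a x _|k IH a] /=; first exact: cst_continuous.
split=> [x _|v]; first exact: differentiable_cst.
have -> : (fun x => 'D_v (fun=> a) x) = (fun=> 0) :> (V -> W).
  by apply/funext => x; exact: derive_cst.
exact: IH.
Qed.

Lemma smooth_on_sub U U' f : (forall x, U x -> U' x) ->
  smooth_on U' f -> smooth_on U f.
Proof.
move=> UU' sf k; elim: k f sf => [f sf x Ux|k IH f sf].
  by apply: (sf 0%N); exact: UU'.
split=> [x Ux|v]; first exact: smooth_differentiable sf (UU' _ Ux).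
by apply: IH; exact: smooth_derive.
Qed.

(** Smoothness is the greatest property that implies differentiability and is
    inherited by directional derivatives. *)
Lemma smooth_coind U (P : (V -> W) -> Prop) :
  (forall f, P f -> forall x, U x -> differentiable f x) ->
  (forall f v, P f -> P (fun x => 'D_v f x)) ->
  forall f, P f -> smooth_on U f.
Proof.
move=> Pd PD f Pf k; elim: k f Pf => [|k IH] f Pf /=.
  by move=> x Ux; apply: differentiable_continuous; exact: Pd.
by split=> [|v]; [exact: Pd | apply/IH/PD].
Qed.

End SmoothOn.

Section SmoothEntries.
Context {R : realType} {V : normedModType R} {m n : nat}.
Implicit Types (F : V -> 'M[R]_(m, n)) (U : set V).

Lemma smooth_entry U F i j : open U ->
  smooth_on U F -> smooth_on U (fun x => F x i j).
Proof.
move=> oU sF k; elim: k F sF => [|k IH] F sF /=.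
  move=> x Ux; apply: differentiable_continuous.
  by apply: differentiable_entry; exact: smooth_differentiable Ux.
split=> [x Ux|v].
  by apply: differentiable_entry; exact: smooth_differentiable Ux.
apply: Ck_on_ext oU _ (IH _ (smooth_derive v sF)) => x Ux.
by rewrite derive_entry //; exact: smooth_differentiable Ux.
Qed.

Lemma smooth_entries U F : open U ->
  (forall i j, smooth_on U (fun x => F x i j)) -> smooth_on U F.
Proof.
move=> oU sF k; elim: k F sF => [|k IH] F sF.
  move=> x Ux; apply: differentiable_continuous.
  by apply: differentiable_entries => i j; exact: smooth_differentiable Ux.
have dF x : U x -> differentiable F x.
  by move=> Ux; apply: differentiable_entries => i j;
     exact: smooth_differentiable Ux.
split=> // v; apply: IH => i j.
apply: smooth_on_ext oU _ (smooth_derive v (sF i j)) => x Ux.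
by rewrite derive_entry //; exact: dF.
Qed.

End SmoothEntries.

Section SmoothAlgebra.
Context {R : realType} {V : normedModType R}.
Variable U : set V.
Hypothesis oU : open U.

(** Expressions built from smooth functions. The rules of differential calculus
    show that this class is stable under directional derivatives, so that a single
    appeal to [smooth_coind] replaces one induction on the order of
    differentiability per operation. These rules hold on U only, whence [alg_ext];
    in a composite the outer function only has to be smooth on a set that contains
    the values taken on U. *)
Inductive smooth_alg : (V -> R) -> Prop :=
| alg_smooth f of smooth_on U f : smooth_alg f
| alg_comp n (U' : set 'rV[R]_n) (g : 'rV[R]_n -> R) (F : V -> 'rV[R]_n) of
    smooth_on U F & smooth_on U' g & (forall x, U x -> U' (F x)) :
    smooth_alg (fun x => g (F x))
| alg_ext f g of smooth_alg f & (forall x, U x -> f x = g x) : smooth_alg g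
| alg_add f g of smooth_alg f & smooth_alg g : smooth_alg (fun x => f x + g x)
| alg_mul f g of smooth_alg f & smooth_alg g : smooth_alg (fun x => f x * g x)
| alg_inv f of smooth_alg f & (forall x, U x -> f x != 0) :
    smooth_alg (fun x => (f x)^-1).

Lemma alg_sum I (r : seq I) (f : I -> V -> R) :
  (forall i, smooth_alg (f i)) -> smooth_alg (fun x => \sum_(i <- r) f i x).
Proof.
move=> sf; elim: r => [|i r IH].
  by apply: alg_ext (alg_smooth (@smooth_cst _ _ _ U 0)) _ => x; rewrite big_nil.
by apply: alg_ext (alg_add (sf i) IH) _ => x _; rewrite big_cons.
Qed.

Lemma alg_differentiable f x : smooth_alg f -> U x -> differentiable f x.
Proof.
move=> sf Ux; elim: sf => {f}.
- by move=> f sf; exact: smooth_differentiable Ux.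
- move=> n U' g F sF sg FU; apply: (@differentiable_comp _ _ _ _ F g).
    exact: smooth_differentiable Ux.
  by apply: smooth_differentiable sg _; exact: FU.
- by move=> f g _ df fg; exact: differentiable_ext fg df.
- by move=> f g _ df _ dg; exact: (@differentiableD _ _ _ f g).
- by move=> f g _ df _ dg; exact: (@differentiableM _ _ f g).
- by move=> f _ df f0; apply: differentiableV => //; exact: f0.
Qed.

(** By the chain rule the derivative of g o F along v is the sum over i of
    (D_v F)_i * (D_i g) o F: composites of the same kind reappear, which is why the
    composite is a constructor of [smooth_alg] instead of a derived closure
    property. *)
Lemma alg_derive f v : smooth_alg f -> smooth_alg (fun x => 'D_v f x).
Proof.
have dv g x : smooth_alg g -> U x -> derivable g x v.
  by move=> sg Ux; apply/diff_derivable/alg_differentiable.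
elim=> {f}.
- by move=> f sf; apply/alg_smooth/smooth_derive.
- move=> n U' g F sF sg FU.
  apply: (@alg_ext
      (fun x => \sum_i ('D_v F x 0 i * 'D_(basis_vec R i) g (F x)))).
    apply: alg_sum => i; apply: alg_mul.
      by apply: alg_smooth; apply: smooth_entry => //; exact: smooth_derive.
    apply: (alg_comp (U' := U') (g := fun y => 'D_(basis_vec R i) g y)) => //.
    exact: smooth_derive.
  move=> x Ux.
  have dF : differentiable F x by exact: smooth_differentiable sF Ux.
  have dg : differentiable g (F x) by apply: smooth_differentiable sg (FU x Ux).
  rewrite [RHS]deriveE; last exact: (@differentiable_comp _ _ _ _ F g).
  have -> : 'd (fun y => g (F y)) x v = 'd g (F x) ('d F x v).
    by rewrite (@diff_comp _ _ _ _ F g).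
  rewrite -(deriveE _ dF) [in RHS](row_basis_sum ('D_v F x)) linear_sum.
  by apply: eq_bigr => i _; rewrite linearZ /= -(deriveE _ dg).
- by move=> f g sf sDf fg; apply: alg_ext sDf _ => x Ux; exact: (derive_ext oU Ux fg).
- move=> f g sf sDf sg sDg; apply: alg_ext (alg_add sDf sDg) _ => x Ux.
  by rewrite -deriveD //; exact: dv.
- move=> f g sf sDf sg sDg.
  apply: alg_ext (alg_add (alg_mul sf sDg) (alg_mul sg sDf)) _ => x Ux.
  by rewrite [RHS](@deriveM _ _ f g) //; exact: dv.
- move=> f sf sDf f0.
  have sV := alg_inv sf f0.
  have sN := alg_smooth (smooth_cst U (-1 : R)).
  apply: alg_ext (alg_mul (alg_mul sN (alg_mul sV sV)) sDf) _ => x Ux.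
  rewrite deriveV //; [|exact: f0|exact: dv].
  by rewrite mulN1r expr2 invfM.
Qed.

Lemma smooth_algP f : smooth_alg f -> smooth_on U f.
Proof.
apply: smooth_coind => g; first by move=> sg x; exact: alg_differentiable.
by move=> v; exact: alg_derive.
Qed.

End SmoothAlgebra.

Section SmoothScalar.
Context {R : realType} {V : normedModType R}.
Variable U : set V.
Hypothesis oU : open U.
Implicit Types f g : V -> R.

Lemma smoothD f g : smooth_on U f -> smooth_on U g ->
  smooth_on U (fun x => f x + g x).
Proof.
by move=> sf sg; apply: smooth_algP oU _ _; apply: alg_add; exact: alg_smooth.
Qed.

Lemma smoothM f g : smooth_on U f -> smooth_on U g ->
  smooth_on U (fun x => f x * g x).
Proof.
by move=> sf sg; apply: smooth_algP oU _ _; apply: alg_mul; exact: alg_smooth.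
Qed.

Lemma smoothN f : smooth_on U f -> smooth_on U (fun x => - f x).
Proof.
move=> sf; apply: smooth_on_ext oU _ (smoothM (smooth_cst U (-1 : R)) sf).
by move=> x _; rewrite mulN1r.
Qed.

Lemma smoothV f : smooth_on U f -> (forall x, U x -> f x != 0) ->
  smooth_on U (fun x => (f x)^-1).
Proof.
by move=> sf f0; apply: smooth_algP oU _ _; apply: alg_inv => //; exact: alg_smooth.
Qed.

Lemma smooth_comp n (U' : set 'rV[R]_n) (g : 'rV[R]_n -> R) (F : V -> 'rV[R]_n) :
  smooth_on U F -> smooth_on U' g -> (forall x, U x -> U' (F x)) ->
  smooth_on U (fun x => g (F x)).
Proof. by move=> sF sg FU; apply: smooth_algP oU _ _; exact: alg_comp FU. Qed.

Lemma smooth_sum I (r : seq I) (f : I -> V -> R) :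
  (forall i, smooth_on U (f i)) -> smooth_on U (fun x => \sum_(i <- r) f i x).
Proof.
by move=> sf; apply: smooth_algP oU _ _; apply: alg_sum => i; exact: alg_smooth.
Qed.

Lemma smooth_prod I (r : seq I) (f : I -> V -> R) :
  (forall i, smooth_on U (f i)) -> smooth_on U (fun x => \prod_(i <- r) f i x).
Proof.
move=> sf; elim: r => [|i r IH].
  by apply: smooth_on_ext oU _ (smooth_cst U (1 : R)) => x _; rewrite big_nil.
by apply: smooth_on_ext oU _ (smoothM (sf i) IH) => x _; rewrite big_cons.
Qed.

Lemma smooth_det n (A : V -> 'M[R]_n) :
  (forall i j, smooth_on U (fun x => A x i j)) ->
  smooth_on U (fun x => \det (A x)).
Proof.
move=> sA; apply: smooth_sum => s; apply: smoothM; first exact: smooth_cst.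
exact: smooth_prod.
Qed.

(** Cramer's rule: the entries of the inverse are cofactors divided by the
    determinant, that is, rational expressions in the entries. *)
Lemma smooth_invmx n (A : V -> 'M[R]_n) :
  (forall i j, smooth_on U (fun x => A x i j)) ->
  (forall x, U x -> A x \in unitmx) ->
  forall i j, smooth_on U (fun x => invmx (A x) i j).
Proof.
move=> sA uA i j.
have sdet : smooth_on U (fun x => (\det (A x))^-1).
  by apply: smoothV => [|x Ux]; [exact: smooth_det|rewrite -unitfE; exact: uA].
have scof : smooth_on U (fun x => cofactor (A x) j i).
  apply: smoothM; first exact: smooth_cst.
  apply: smooth_det => k l; apply: smooth_on_ext oU _ (sA _ _) => x _.
  by rewrite !mxE.
apply: smooth_on_ext oU _ (smoothM sdet scof) => x Ux.
by rewrite /invmx uA // !mxE.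
Qed.

End SmoothScalar.

(** * Symmetry of second derivatives *)

Section Schwarz.
Context {R : realType} {V : normedModType R}.
Implicit Types (f : V -> R) (U : set V) (x u v : V).

Lemma is_derive_line f y u (s : R) : differentiable f (y + s *: u) ->
  is_derive s 1 (fun r : R => f (y + r *: u)) ('D_u f (y + s *: u)).
Proof.
move=> df.
have dl : is_diff s (cst y + ( *:%R^~ u)) (0 + ( *:%R^~ u)).
  by apply: is_diffD.
have dfl : is_diff s (f \o (cst y + ( *:%R^~ u))) ('d f (y + s *: u) \o (0 + ( *:%R^~ u))).
  by apply: is_diff_comp => //; exact: differentiableP.
apply: DeriveDef; first by apply: diff_derivable; exact: (@ex_diff _ _ _ _ _ _ _ dfl).
by rewrite deriveE ?(@diff_val _ _ _ _ _ _ _ dfl) ?fctE ?deriveE //= add0r scale1r.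
Qed.

(** The mean value theorem is used twice, along u for the difference of f
    between the two sides of a parallelogram that are parallel to u, then along v
    for D_u f. *)
Lemma second_difference f U x u v (h : R) : smooth_on U f -> 0 < h ->
  (forall s t, 0 <= s <= h -> 0 <= t <= h -> U (x + s *: u + t *: v)) ->
  exists s t : R, [/\ 0 <= s <= h, 0 <= t <= h &
    f (x + h *: u + h *: v) - f (x + h *: u) - (f (x + h *: v) - f x)
    = h ^+ 2 * 'D_v (fun y => 'D_u f y) (x + s *: u + t *: v)].
Proof.
move=> sf h0 Uh.
have hh : 0 <= h <= h by rewrite lexx ltW.
have h00 : 0 <= (0 : R) <= h by rewrite lexx ltW.
pose phi s := f (x + h *: v + s *: u) - f (x + s *: u).
have dphi (s : R) : 0 <= s <= h -> is_derive s 1 phi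
   ('D_u f (x + h *: v + s *: u) - 'D_u f (x + s *: u)).
  move=> s0h; apply: is_deriveB; apply: is_derive_line.
    rewrite addrAC; apply: smooth_differentiable sf _; exact: Uh.
  rewrite -[x + _]addr0 -(scale0r v).
  by apply: smooth_differentiable sf _; exact: Uh.
have [s s0h phiE] : exists2 c, c \in `]0, h[ & phi h - phi 0 =
    ('D_u f (x + h *: v + c *: u) - 'D_u f (x + c *: u)) * (h - 0).
  apply: (MVT h0) => [s|].
    by rewrite in_itv/= => /andP[/ltW s0 /ltW sh]; apply: dphi; rewrite s0.
  apply: derivable_within_continuous => s; rewrite in_itv/= => s0h.
  by have [] := dphi s s0h.
have {}s0h : 0 <= s <= h.
  by move: s0h; rewrite in_itv/= => /andP[/ltW -> /ltW ->].
pose psi t := 'D_u f (x + s *: u + t *: v).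
have dpsi (t : R) : 0 <= t <= h -> is_derive t 1 psi
   ('D_v (fun y => 'D_u f y) (x + s *: u + t *: v)).
  move=> t0h; apply: is_derive_line.
  by apply: smooth_differentiable (smooth_derive u sf) _; exact: Uh.
have [t t0h psiE] : exists2 c, c \in `]0, h[ & psi h - psi 0 =
    'D_v (fun y => 'D_u f y) (x + s *: u + c *: v) * (h - 0).
  apply: (MVT h0) => [t|].
    by rewrite in_itv/= => /andP[/ltW t0 /ltW th]; apply: dpsi; rewrite t0.
  apply: derivable_within_continuous => t; rewrite in_itv/= => t0h.
  by have [] := dpsi t t0h.
have {}t0h : 0 <= t <= h.
  by move: t0h; rewrite in_itv/= => /andP[/ltW -> /ltW ->].
exists s, t; split => //.
move: phiE psiE; rewrite /phi /psi !scale0r !addr0 !subr0 => phiE psiE.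
rewrite (addrAC x (h *: u)) phiE (addrAC x (h *: v)) psiE.
by rewrite expr2 -mulrA mulrC.
Qed.

(** The second difference of f over the parallelogram with sides h u and h v is
    symmetric in u and v; divided by h^2 it is a value of either mixed derivative
    at some point of the parallelogram, and the mixed derivatives are continuous
    at x. *)
Lemma derive_swap f U x u v : open U -> smooth_on U f -> U x ->
  'D_u (fun y => 'D_v f y) x = 'D_v (fun y => 'D_u f y) x.
Proof.
move=> oU sf Ux.
have cont a b : {for x, continuous (fun y => 'D_a (fun y => 'D_b f y) y)}.
  by apply: (smooth_derive a (smooth_derive b sf) 0%N).
apply/eqP; rewrite -subr_eq0 -normr_le0; apply/ler_addgt0Pl => e e0.
rewrite addr0.
have near_x a b : \forall y \near x,
    `|'D_a (fun y => 'D_b f y) x - 'D_a (fun y => 'D_b f y) y| < e / 2.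
  by move: (cont a b) => /cvgrPdist_lt; apply; rewrite divr_gt0.
have : \forall y \near x, [/\ U y,
    `|'D_u (fun y => 'D_v f y) x - 'D_u (fun y => 'D_v f y) y| < e / 2 &
    `|'D_v (fun y => 'D_u f y) x - 'D_v (fun y => 'D_u f y) y| < e / 2].
  apply: filterS3 (open_nbhs_nbhs (conj oU Ux)) (near_x u v) (near_x v u).
  by move=> y; split.
move=> /nbhs_ballP[r /= r0 xr].
(* The added 1 keeps the denominator positive when u = v = 0. *)
pose h := r / (2 * (`|u| + `|v| + 1)).
have N0 : 0 < `|u| + `|v| + 1 by rewrite ltr_wpDl ?addr_ge0.
have h0 : 0 < h by rewrite divr_gt0 // mulr_gt0.
have inball a b (s t : R) : `|a| + `|b| = `|u| + `|v| ->
    0 <= s <= h -> 0 <= t <= h -> ball x r (x + s *: a + t *: b).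
  move=> ab /andP[s0 sh] /andP[t0 th].
  rewrite -ball_normE /= -addrA opprD addNKr normrN.
  apply: (@le_lt_trans _ _ (h * (`|u| + `|v|))).
    rewrite -ab mulrDr (le_trans (ler_normD _ _)) // !normrZ !ger0_norm //.
    by apply: lerD; apply: ler_wpM2r.
  apply: (@lt_le_trans _ _ (h * (2 * (`|u| + `|v| + 1)))).
    by rewrite ltr_pM2l //; lra.
  by rewrite divfK // gt_eqF // mulr_gt0.
have Uuv s t (s0h : 0 <= s <= h) (t0h : 0 <= t <= h) : U (x + s *: u + t *: v).
  by have [] := xr _ (inball u v s t erefl s0h t0h).
have Uvu s t (s0h : 0 <= s <= h) (t0h : 0 <= t <= h) : U (x + s *: v + t *: u).
  by have [] := xr _ (inball v u s t (addrC _ _) s0h t0h).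
have [s [t [s0h t0h E1]]] := second_difference sf h0 Uuv.
have [s' [t' [s0h' t0h' E2]]] := second_difference sf h0 Uvu.
have E : 'D_v (fun y => 'D_u f y) (x + s *: u + t *: v) =
         'D_u (fun y => 'D_v f y) (x + s' *: v + t' *: u).
  apply: (@mulfI _ (h ^+ 2)); first by rewrite expf_neq0 // gt_eqF.
  have second_diffC (A A' B C D X Y : R) : A = A' ->
      A - B - (C - D) = X -> A' - C - (B - D) = Y -> X = Y.
    by move=> -> <- <-; ring.
  exact: (second_diffC _ _ _ _ _ _ _ (congr1 f (addrAC x _ _)) E1 E2).
have [_ _ Ha] := xr _ (inball u v s t erefl s0h t0h).
have [_ Hb _] := xr _ (inball v u s' t' (addrC _ _) s0h' t0h').
rewrite E in Ha.
have tri (a b c : R) : `|a - c| < e / 2 -> `|b - c| < e / 2 -> `|a - b| <= e.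
  move=> ac bc; apply: le_trans (ler_distD c _ _) _.
  by rewrite (distrC c) [leRHS]splitr; apply: lerD; exact: ltW.
exact: tri Hb Ha.
Qed.

Lemma derive_swap_mx m n (F : V -> 'M[R]_(m, n)) U x u v :
  open U -> smooth_on U F -> U x ->
  'D_u (fun y => 'D_v F y) x = 'D_v (fun y => 'D_u F y) x.
Proof.
move=> oU sF Ux.
have entry a b i j : 'D_a (fun y => 'D_b F y) x i j =
    'D_a (fun y => 'D_b (fun z => F z i j) y) x.
  rewrite derive_entry; last first.
    exact: smooth_differentiable (smooth_derive b sF) Ux.
  apply: (derive_ext oU Ux) => y Uy.
  by rewrite derive_entry //; exact: smooth_differentiable Uy.
apply/matrixP => i j; apply: etrans (entry u v i j) _.
apply: etrans _ (esym (entry v u i j)).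
exact: derive_swap oU (smooth_entry i j oU sF) Ux.
Qed.

End Schwarz.

(** * Product rule for bilinear expressions with variable coefficients *)

(** Both the metric and the Christoffel symbols are bilinear in tangent vectors
    with coefficients that depend on the base point. The rules below
    differentiate such an expression along a map F into the base. *)
Section BilinearProductRule.
Context {R : realType} {V : normedModType R} {n : nat}.
Local Notation vec := 'rV[R]_n.
Local Notation e := (@basis_vec R n).

Section Scalar.
Variable b : vec -> vec -> vec -> R.
Hypothesis bb : forall y, bilin (b y : vec -> vec -> R^o).

Let bE y u v : b y u v = \sum_i \sum_j u 0 i * v 0 j * b y (e i) (e j).
Proof. exact: (bilinE (bb y)). Qed.

Lemma smooth_bilin (U : set V) (U' : set vec) (F X Y : V -> vec) : open U ->
  smooth_on U F -> smooth_on U X -> smooth_on U Y ->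
  (forall x, U x -> U' (F x)) ->
  (forall i j, smooth_on U' (fun y => b y (e i) (e j))) ->
  smooth_on U (fun x => b (F x) (X x) (Y x)).
Proof.
move=> oU sF sX sY FU sb.
have -> : (fun x => b (F x) (X x) (Y x)) =
    (fun x => \sum_i \sum_j X x 0 i * Y x 0 j * b (F x) (e i) (e j)).
  by apply/funext => x; exact: bE.
apply: (smooth_sum oU) => i; apply: (smooth_sum oU) => j.
apply: (smoothM oU); last exact: (smooth_comp oU sF (sb i j) FU).
by apply: (smoothM oU); exact: smooth_entry.
Qed.

Lemma is_derive_bilin_arg y w u v :
  (forall i j, differentiable (fun y => b y (e i) (e j)) y) ->
  is_derive y w (fun y => b y u v)
    (\sum_i \sum_j u 0 i * v 0 j * 'D_w (fun y => b y (e i) (e j)) y).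
Proof.
move=> db.
have -> : (fun y => b y u v) =
    \sum_i \sum_j (u 0 i * v 0 j) *: (fun y => b y (e i) (e j)).
  apply/funext => z; rewrite bE fct_sumE; apply: eq_bigr => i _.
  by rewrite fct_sumE.
apply: is_derive_sum => i; apply: is_derive_sum => j.
by apply: is_deriveZ; apply: derivableP; exact: diff_derivable.
Qed.

(** Expand in the basis: each term is a product of an entry of X, an entry of Y
    and a coefficient composed with F, and the three parts of the Leibniz rule are
    summed separately. *)
Lemma derive_bilin (F X Y : V -> vec) x z :
  differentiable F x -> differentiable X x -> differentiable Y x ->
  (forall i j, differentiable (fun y => b y (e i) (e j)) (F x)) ->
  'D_z (fun x => b (F x) (X x) (Y x)) x =
  'D_('D_z F x) (fun y => b y (X x) (Y x)) (F x)
  + b (F x) ('D_z X x) (Y x) + b (F x) (X x) ('D_z Y x).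
Proof.
move=> dF dX dY db.
have -> : (fun x => b (F x) (X x) (Y x)) =
    \sum_i \sum_j ((fun x => X x 0 i) * (fun x => Y x 0 j)) *
      (fun x => b (F x) (e i) (e j)).
  apply/funext => u; rewrite bE fct_sumE; apply: eq_bigr => i _.
  by rewrite fct_sumE.
have dentry (Z : V -> vec) i : differentiable Z x ->
    is_derive x z (fun x => Z x 0 i) ('D_z Z x 0 i).
  move=> dZ; rewrite derive_entry //; apply: derivableP; apply: diff_derivable.
  exact: differentiable_entry.
have dbF i j : is_derive x z (fun x => b (F x) (e i) (e j))
    ('D_('D_z F x) (fun y => b y (e i) (e j)) (F x)).
  have dbF' := @differentiable_comp _ _ _ _ F (fun y => b y (e i) (e j)) x dF (db i j).
  apply: DeriveDef; first exact: diff_derivable.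
  by rewrite deriveE // (@diff_comp _ _ _ _ F (fun y => b y (e i) (e j))) //= !deriveE.
have H : is_derive x z
    (\sum_i \sum_j ((fun x => X x 0 i) * (fun x => Y x 0 j)) *
      (fun x => b (F x) (e i) (e j)))
    (\sum_i \sum_j ((X x 0 i * Y x 0 j) *:
        'D_('D_z F x) (fun y => b y (e i) (e j)) (F x)
      + b (F x) (e i) (e j) *: (X x 0 i *: 'D_z Y x 0 j + Y x 0 j *: 'D_z X x 0 i))).
  apply: is_derive_sum => i; apply: is_derive_sum => j.
  by apply: is_deriveM; apply: is_deriveM; exact: dentry.
rewrite (@derive_val _ _ _ _ _ _ _ H).
rewrite (@derive_val _ _ _ _ _ _ _ (is_derive_bilin_arg _ _ _ db)).
rewrite (bE _ ('D_z X x)) (bE _ (X x)) -!big_split /=; apply: eq_bigr => i _.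
rewrite -!big_split /=; apply: eq_bigr => j _.
rewrite /GRing.scale /=.
move: ('D_('D_z F x) _ _) (b _ _ _) ('D_z Y x 0 j) ('D_z X x 0 i) => p q r s.
by move: (X x 0 i) (Y x 0 j) => X0 Y0; ring.
Qed.

End Scalar.

Section Vector.
Variables (m : nat) (b : vec -> vec -> vec -> 'rV[R]_m).
Hypothesis bb : forall y, bilin (b y).

Let bbk k y : bilin (fun u v => b y u v 0 k : R^o).
Proof.
split=> [u a v v'|v a u u']; rewrite ?(bilinDr (bb y)) ?(bilinZr (bb y));
by rewrite /= ?(bilinDl (bb y)) ?(bilinZl (bb y)) !mxE.
Qed.

Lemma smooth_bilin_vec (U : set V) (U' : set vec) (F X Y : V -> vec) : open U ->
  smooth_on U F -> smooth_on U X -> smooth_on U Y ->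
  (forall x, U x -> U' (F x)) -> open U' ->
  (forall i j, smooth_on U' (fun y => b y (e i) (e j))) ->
  smooth_on U (fun x => b (F x) (X x) (Y x)).
Proof.
move=> oU sF sX sY FU oU' sb; apply: (smooth_entries oU) => i k.
rewrite (ord1 i).
apply: (@smooth_bilin (fun y u v => b y u v 0 k) (bbk k) U U') => // i' j'.
exact: smooth_entry.
Qed.

Lemma derive_bilin_vec (F X Y : V -> vec) x z :
  differentiable F x -> differentiable X x -> differentiable Y x ->
  (forall i j, differentiable (fun y => b y (e i) (e j)) (F x)) ->
  'D_z (fun x => b (F x) (X x) (Y x)) x =
  'D_('D_z F x) (fun y => b y (X x) (Y x)) (F x)
  + b (F x) ('D_z X x) (Y x) + b (F x) (X x) ('D_z Y x).
Proof.
move=> dF dX dY db.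
have dbk k i j : differentiable (fun y => b y (e i) (e j) 0 k) (F x).
  exact: differentiable_entry.
have dby u v : differentiable (fun y => b y u v) (F x).
  have -> : (fun y => b y u v) =
      \sum_i \sum_j (u 0 i * v 0 j) *: (fun y => b y (e i) (e j)).
    apply/funext => y; rewrite (bilinE (bb y)) fct_sumE; apply: eq_bigr => i _.
    by rewrite fct_sumE.
  by apply: differentiable_sum => i; apply: differentiable_sum => j; exact: differentiableZ.
have dbF : differentiable (fun x => b (F x) (X x) (Y x)) x.
  have -> : (fun x => b (F x) (X x) (Y x)) = \sum_i \sum_j
      (fun x => (X x 0 i * Y x 0 j) *: b (F x) (e i) (e j)).
    apply/funext => y; rewrite (bilinE (bb _)) fct_sumE; apply: eq_bigr => i _.
    by rewrite fct_sumE.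
  apply: differentiable_sum => i; apply: differentiable_sum => j.
  apply: differentiable_entries => o k; rewrite (ord1 o).
  have -> : (fun y => ((X y 0 i * Y y 0 j) *: b (F y) (e i) (e j)) 0 k) =
    (fun y => X y 0 i) * (fun y => Y y 0 j) * (fun y => b (F y) (e i) (e j) 0 k).
    by apply/funext => y; rewrite mxE.
  apply: differentiableM.
    by apply: differentiableM; exact: differentiable_entry.
  exact: (@differentiable_comp _ _ _ _ F (fun y => b y (e i) (e j) 0 k)).
apply/rowP => k; rewrite derive_entry //.
rewrite (@derive_bilin (fun y u v => b y u v 0 k) (bbk k)) //.
by rewrite [RHS]mxE [X in _ = X + _]mxE derive_entry.
Qed.

End Vector.
End BilinearProductRule.

(** * The Levi-Civita connection in a chart *)

Section GammaBilin.
Context {R : realType} {n : nat}.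
Variable H : 'rV[R]_n -> 'M[R]_n.

Lemma Gamma_bilin y : bilin (Gamma H y).
Proof.
split=> [u a v v'|v a u u']; apply/rowP => k; rewrite !mxE mulr_sumr -big_split;
  apply: eq_bigr => i _ /=; rewrite mulr_sumr -big_split;
  apply: eq_bigr => j _ /=; rewrite !mxE; ring.
Qed.

Lemma Gamma_basis y i j k :
  Gamma H y (basis_vec R i) (basis_vec R j) 0 k = christoffel H y k i j.
Proof.
rewrite mxE (bigD1 i) //= [X in _ + X]big1 ?addr0 => [|i' ii'].
  rewrite (bigD1 j) //= [X in _ + X]big1 ?addr0 => [|j' jj'].
    by rewrite !mxE !eqxx !mulr1.
  by rewrite !mxE (negPf jj') andbF mulr0.
by apply: big1 => j' _; rewrite !mxE (negPf ii') andbF mulr0 mul0r.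
Qed.

End GammaBilin.

Section LeviCivita.
Context {R : realType} {n : nat}.
Variables (H : 'rV[R]_n -> 'M[R]_n) (U : set 'rV[R]_n).
Hypothesis oU : open U.
Hypothesis sH : smooth_on U H.
Hypothesis Hsym : forall y, U y -> (H y)^T = H y.
Hypothesis Hpos : forall y, U y -> forall u, u != 0 -> 0 < inner H y u u.
Implicit Types (y u v w : 'rV[R]_n).
Local Notation e := (@basis_vec R n).

Lemma smooth_metric_entry i j : smooth_on U (fun y => inner H y (e i) (e j)).
Proof.
have -> : (fun y => inner H y (e i) (e j)) = (fun y => H y i j).
  by apply/funext => y; exact: inner_basis.
exact: smooth_entry.
Qed.

Lemma smooth_christoffel k i j : smooth_on U (fun y => christoffel H y k i j).
Proof.
apply: (smoothM oU); first exact: smooth_cst.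
apply: (smooth_sum oU) => l; apply: (smoothM oU).
  apply: (smooth_invmx oU) => [i' j'|y Uy]; first exact: smooth_entry.
  by apply: posdef_unitmx; exact: Hpos.
by apply: (smoothD oU); [apply: (smoothD oU)|apply: (smoothN oU)];
  apply: smooth_derive; exact: smooth_entry.
Qed.

Lemma smooth_Gamma_basis i j : smooth_on U (fun y => Gamma H y (e i) (e j)).
Proof.
apply: (smooth_entries oU) => o k; rewrite (ord1 o).
have -> : (fun y => Gamma H y (e i) (e j) 0 k) = (fun y => christoffel H y k i j).
  by apply/funext => y; exact: Gamma_basis.
exact: smooth_christoffel.
Qed.

Lemma differentiable_Gamma_basis y i j : U y ->
  differentiable (fun y => Gamma H y (e i) (e j)) y.
Proof. exact: smooth_differentiable (smooth_Gamma_basis i j). Qed.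

Lemma derive_inner_sym y w u v : U y ->
  'D_w (fun y => inner H y u v) y = 'D_w (fun y => inner H y v u) y.
Proof.
move=> Uy; apply: (derive_ext oU Uy) => z Uz; apply: innerC; exact: Hsym.
Qed.

Lemma GammaC y u v : U y -> Gamma H y u v = Gamma H y v u.
Proof.
move=> Uy; rewrite (bilinE (Gamma_bilin H y)) [RHS](bilinE (Gamma_bilin H y)).
rewrite exchange_big; apply: eq_bigr => j _; apply: eq_bigr => i _ /=.
rewrite mulrC; congr (_ *: _); apply/rowP => k; rewrite !Gamma_basis.
rewrite /christoffel; congr (_ * _); apply: eq_bigr => l _; congr (_ * _).
rewrite [X in X - _ = _]addrC; congr (_ - _).
apply: (derive_ext oU Uy) => z Uz; rewrite -[in LHS](Hsym Uz); exact: mxE.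
Qed.

(** The Koszul formula for constant vector fields: pairing with w contracts the
    inverse metric that occurs in the Christoffel symbols with the metric. All
    metric properties of the connection are derived from this formula. *)
Lemma inner_Gamma y u v w : U y -> inner H y (Gamma H y u v) w =
  2^-1 * ('D_u (fun y => inner H y v w) y + 'D_v (fun y => inner H y u w) y
          - 'D_w (fun y => inner H y u v) y).
Proof.
move=> Uy.
have dH i j : differentiable (fun y => inner H y (e i) (e j)) y.
  exact: smooth_differentiable (smooth_metric_entry i j) Uy.
pose dHe a i j := 'D_(e a) (fun y => H y i j) y.
have DE a b c : 'D_a (fun y => inner H y b c) y =
    \sum_i \sum_j \sum_k a 0 k * b 0 i * c 0 j * dHe k i j.
  have DH := @is_derive_bilin_arg R n (inner H) (inner_bilin H) y a b c dH.
  rewrite (@derive_val _ _ _ _ _ _ _ DH).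
  apply: eq_bigr => i _; apply: eq_bigr => j _.
  rewrite [X in 'D_X _ _](row_basis_sum a) deriveE //.
  rewrite linear_sum mulr_sumr; apply: eq_bigr => k _.
  rewrite linearZ /= -deriveE // /dHe.
  have -> : (fun y0 => inner H y0 (e i) (e j)) = (fun y0 => H y0 i j).
    by apply/funext => z; exact: inner_basis.
  by rewrite /GRing.scale /=; ring.
have key i j : inner H y (Gamma H y (e i) (e j)) w =
    2^-1 * \sum_l w 0 l * (dHe i j l + dHe j i l - dHe l i j).
  pose c := \row_l (dHe i j l + dHe j i l - dHe l i j).
  have -> : Gamma H y (e i) (e j) = 2^-1 *: (c *m (invmx (H y))).
    apply/rowP => k; rewrite Gamma_basis /christoffel !mxE; congr (_ * _).
    apply: eq_bigr => l _; rewrite mxE mulrC; congr (_ * _).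
    by rewrite -[in RHS](Hsym Uy) -trmx_inv mxE.
  rewrite innerZl /inner mulmxKV; last by apply: posdef_unitmx; exact: Hpos.
  rewrite !mxE; congr (_ * _); apply: eq_bigr => l _.
  by rewrite !mxE mulrC.
rewrite (bilinE (Gamma_bilin H y)) inner_suml.
under eq_bigr do rewrite inner_suml.
under eq_bigr do under eq_bigr do rewrite innerZl key.
rewrite !DE.
(* Each derivative carries its own triple sum; all are brought to the order in
   which i and j index u and v and the innermost index is that of w. *)
have inner_swap (F : 'I_n -> 'I_n -> 'I_n -> R) :
    \sum_i \sum_j \sum_k F i j k = \sum_i \sum_k \sum_j F i j k.
  by apply: eq_bigr => i _; exact: exchange_big.
rewrite [X in _ * (X + _ - _)]inner_swap [X in _ * (X + _ - _)]exchange_big /=.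
rewrite [X in _ * (_ + X - _)]inner_swap -sumrN -!big_split mulr_sumr /=.
apply: eq_bigr => i _; rewrite -sumrN -!big_split mulr_sumr /=.
apply: eq_bigr => j _; rewrite -sumrN -!big_split mulrCA /=; congr (_ * _).
by rewrite mulr_sumr; apply: eq_bigr => l _; ring.
Qed.

End LeviCivita.

(** * The pull-back connection along a map *)

Section SmoothVector.
Context {R : realType} {V : normedModType R}.
Variable U : set V.
Hypothesis oU : open U.

Lemma smooth_id : smooth_on U (id : V -> V).
Proof.
case=> [|k]; first by move=> x _; exact: cvg_id.
split=> [x _|v]; first by [].
have -> : (fun x => 'D_v (id : V -> V) x) = (fun=> v).
  by apply/funext => x; exact: derive_id.
exact: smooth_cst.
Qed.

Lemma smooth_mxD m n (F G : V -> 'M[R]_(m, n)) : smooth_on U F -> smooth_on U G ->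
  smooth_on U (fun x => F x + G x).
Proof.
move=> sF sG; apply: (smooth_entries oU) => i j.
have -> : (fun x => (F x + G x) i j) = (fun x => F x i j + G x i j).
  by apply/funext => x; rewrite mxE.
by apply: (smoothD oU); exact: smooth_entry.
Qed.

Lemma smooth_mxZ m n (a : V -> R) (G : V -> 'M[R]_(m, n)) :
  smooth_on U a -> smooth_on U G -> smooth_on U (fun x => a x *: G x).
Proof.
move=> sa sG; apply: (smooth_entries oU) => i j.
have -> : (fun x => (a x *: G x) i j) = (fun x => a x * G x i j).
  by apply/funext => x; rewrite mxE.
by apply: (smoothM oU) => //; exact: smooth_entry.
Qed.

Lemma smooth_mx_sum m n I (r : seq I) (F : I -> V -> 'M[R]_(m, n)) :
  (forall i, smooth_on U (F i)) -> smooth_on U (fun x => \sum_(i <- r) F i x).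
Proof.
move=> sF; elim: r => [|i r IH].
  by apply: smooth_on_ext oU _ (smooth_cst U 0) => x _; rewrite big_nil.
by apply: smooth_on_ext oU _ (smooth_mxD (sF i) IH) => x _; rewrite big_cons.
Qed.

End SmoothVector.

(** Bookkeeping for [cov_curvature]: A stands for a second derivative of V, B for
    the term with a second derivative of f, D and E for the terms with one
    derivative of V, C and F for the derivative and the square of the Christoffel
    symbols. *)
Section SumIdentities.
Context {Z : zmodType}.

Lemma second_cov_sum (A B C D E F : Z) :
  A + (C + B + D) + (E + F) = A + B + (D + E) + (C + F).
Proof.
by rewrite !addrA; congr (_ + F); rewrite -!addrA; congr (A + _);
   rewrite !addrA (addrC C B) -!addrA; congr (_ + _); rewrite addrC addrA.
Qed.

Lemma commutator_sum (A1 A2 B1 B2 D E C1 C2 F1 F2 X Y : Z) :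
  A1 = A2 -> B1 = B2 ->
  X = A1 + B1 + (D + E) + (C1 + F1) -> Y = A2 + B2 + (E + D) + (C2 + F2) ->
  X - Y = C1 - C2 + (F1 - F2).
Proof.
move=> -> -> -> ->.
by rewrite (addrC E) opprD addrACA subrr add0r opprD addrACA.
Qed.

End SumIdentities.

Section Pullback.
Context {R : realType} {m n : nat}.
Variables (U : set 'rV[R]_m) (U' : set 'rV[R]_n).
Variables (H : 'rV[R]_n -> 'M[R]_n) (f : 'rV[R]_m -> 'rV[R]_n).
Hypotheses (oU : open U) (oU' : open U').
Hypothesis sH : smooth_on U' H.
Hypothesis Hsym : forall y, U' y -> (H y)^T = H y.
Hypothesis Hpos : forall y, U' y -> forall u, u != 0 -> 0 < inner H y u u.
Hypothesis sf : smooth_on U f.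
Hypothesis fU : forall x, U x -> U' (f x).
Implicit Types (V W : 'rV[R]_m -> 'rV[R]_n) (x u v w : 'rV[R]_m).

Local Notation cov w V := (pnabla H f (cst w) V).

Lemma covE w V x : cov w V x = 'D_w V x + Gamma H (f x) ('D_w f x) (V x).
Proof. by []. Qed.

Let df x : U x -> differentiable f x.
Proof. exact: smooth_differentiable. Qed.

Lemma smooth_pairing V W : smooth_on U V -> smooth_on U W ->
  smooth_on U (fun x => inner H (f x) (V x) (W x)).
Proof.
move=> sV sW; apply: (smooth_bilin (inner_bilin H) oU sf sV sW fU) => i j.
exact: smooth_metric_entry.
Qed.

Lemma smooth_cov w V : smooth_on U V -> smooth_on U (cov w V).
Proof.
move=> sV; apply: smooth_mxD => //; first exact: smooth_derive.
apply: (smooth_bilin_vec (Gamma_bilin H) oU sf (smooth_derive w sf) sV fU oU').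
by move=> i j; exact: smooth_Gamma_basis.
Qed.

Lemma covD w V W x : U x -> smooth_on U V -> smooth_on U W ->
  cov w (fun y => V y + W y) x = cov w V x + cov w W x.
Proof.
move=> Ux sV sW; rewrite !covE (bilinDr (Gamma_bilin H _)).
rewrite (@deriveD _ _ _ V W); [|exact/diff_derivable/(smooth_differentiable sV)
                                |exact/diff_derivable/(smooth_differentiable sW)].
by rewrite addrACA.
Qed.

Lemma covZ w (a : R) V x : U x -> smooth_on U V ->
  cov w (fun y => a *: V y) x = a *: cov w V x.
Proof.
move=> Ux sV; rewrite !covE (bilinZr (Gamma_bilin H _)) scalerDr.
by rewrite (@deriveZ _ _ _ V) //; exact/diff_derivable/(smooth_differentiable sV).
Qed.

Lemma cov_dirD u v V x : U x -> smooth_on U V ->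
  cov (u + v) V x = cov u V x + cov v V x.
Proof.
move=> Ux sV; rewrite !covE (derive_dirD _ _ (df Ux)).
rewrite (derive_dirD _ _ (smooth_differentiable sV Ux)).
by rewrite (bilinDl (Gamma_bilin H _)) addrACA.
Qed.

Lemma cov_dirZ (a : R) v V x : U x -> smooth_on U V ->
  cov (a *: v) V x = a *: cov v V x.
Proof.
move=> Ux sV; rewrite !covE (derive_dirZ _ _ (df Ux)).
rewrite (derive_dirZ _ _ (smooth_differentiable sV Ux)).
by rewrite (bilinZl (Gamma_bilin H _)) scalerDr.
Qed.

(** The Leibniz rule leaves the derivative of the metric in the direction of the
    velocity of f; adding two instances of the Koszul formula, the terms with a
    derivative in the direction of V or W cancel and exactly this derivative
    remains. *)
Lemma cov_metric w V W x : U x -> smooth_on U V -> smooth_on U W ->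
  'D_w (fun y => inner H (f y) (V y) (W y)) x =
  inner H (f x) (cov w V x) (W x) + inner H (f x) (V x) (cov w W x).
Proof.
move=> Ux sV sW; have U'f := fU Ux.
have dH i j : differentiable
    (fun y => inner H y (basis_vec R i) (basis_vec R j)) (f x).
  exact: smooth_differentiable (smooth_metric_entry oU' sH i j) U'f.
rewrite (derive_bilin (inner_bilin H) w (df Ux) (smooth_differentiable sV Ux)
  (smooth_differentiable sW Ux) dH).
rewrite !covE innerDl innerDr.
rewrite (innerC (Hsym U'f) (V x) (Gamma _ _ _ _)).
rewrite !(inner_Gamma oU' sH Hsym Hpos) //.
rewrite (derive_inner_sym oU' Hsym _ (V x) (W x) U'f).
set A := 'D_('D_w f x) _ _; set B := 'D_(V x) _ _; set C := 'D_(W x) _ _.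
set D := inner _ _ ('D_w V x) _; set E := inner _ _ _ ('D_w W x).
by clearbody A B C D E; lra.
Qed.

(** Second partial derivatives commute and the Christoffel symbols are symmetric. *)
Lemma cov_torsion u v x : U x ->
  cov u (fun y => 'D_v f y) x = cov v (fun y => 'D_u f y) x.
Proof.
move=> Ux.
exact: (congr2 +%R (derive_swap_mx u v oU sf Ux) (GammaC oU' Hsym _ _ (fU Ux))).
Qed.

Lemma riemE y (a b w : 'rV[R]_n) : riem H y a b w =
  'D_a (fun y => Gamma H y b w) y - 'D_b (fun y => Gamma H y a w) y
  + (Gamma H y a (Gamma H y b w) - Gamma H y b (Gamma H y a w)).
Proof.
have nE d z : nabla H (cst d) (cst w) z = Gamma H z d w.
  by rewrite /nabla derive_cst add0r.
rewrite /riem /curvature.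
have -> : nabla H (lie_bracket (cst a) (cst b)) (cst w) y = 0.
  rewrite /nabla derive_cst add0r /lie_bracket !derive_cst subrr.
  exact: bilin0l (Gamma_bilin H y) _.
have -> : nabla H (cst b) (cst w) = (fun z => Gamma H z b w) by apply/funext.
have -> : nabla H (cst a) (cst w) = (fun z => Gamma H z a w) by apply/funext.
by rewrite subr0 /nabla opprD addrACA.
Qed.

(** By the chain rule the covariant second derivative of V contains the
    derivative of the Christoffel symbols of the target along f; in the commutator
    the terms that contain derivatives of V or second derivatives of f are
    symmetric and cancel. *)
Lemma cov_curvature u v V x : U x -> smooth_on U V ->
  cov u (cov v V) x - cov v (cov u V) x =
  riem H (f x) ('D_u f x) ('D_v f x) (V x).
Proof.
move=> Ux sV.
have sG w : smooth_on U (fun y => Gamma H (f y) ('D_w f y) (V y)).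
  apply: (smooth_bilin_vec (Gamma_bilin H) oU sf (smooth_derive w sf) sV fU oU').
  by move=> i j; exact: smooth_Gamma_basis.
have half a b : cov a (cov b V) x =
    'D_a (fun y => 'D_b V y) x + Gamma H (f x) ('D_a (fun y => 'D_b f y) x) (V x)
    + (Gamma H (f x) ('D_b f x) ('D_a V x) + Gamma H (f x) ('D_a f x) ('D_b V x))
    + ('D_('D_a f x) (fun y => Gamma H y ('D_b f x) (V x)) (f x)
       + Gamma H (f x) ('D_a f x) (Gamma H (f x) ('D_b f x) (V x))).
  have E1 := @deriveD _ _ _ (fun y => 'D_b V y)
    (fun y => Gamma H (f y) ('D_b f y) (V y)) x a
    (diff_derivable (smooth_differentiable (smooth_derive b sV) Ux))
    (diff_derivable (smooth_differentiable (sG b) Ux)).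
  have E2 := derive_bilin_vec (Gamma_bilin H) a (df Ux)
    (smooth_differentiable (smooth_derive b sf) Ux)
    (smooth_differentiable sV Ux)
    (fun i j => differentiable_Gamma_basis oU' sH Hpos i j (fU Ux)).
  have E3 := bilinDr (Gamma_bilin H (f x)) ('D_a f x) ('D_b V x)
    (Gamma H (f x) ('D_b f x) (V x)).
  exact: etrans (congr2 +%R (etrans E1 (congr1 _ E2)) E3) (second_cov_sum _ _ _ _ _ _).
apply: etrans (esym (riemE _ _ _ _)).
exact: (commutator_sum (derive_swap_mx u v oU sV Ux)
  (congr1 (fun z => Gamma H (f x) z (V x)) (derive_swap_mx u v oU sf Ux))
  (half u v) (half v u)).
Qed.

(** The ordinary second derivatives of the function <V, V> commute; expanded
    with [cov_metric], their difference is twice the left-hand side. *)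
Lemma cov_curvature_skew u v V x : U x -> smooth_on U V ->
  inner H (f x) (cov u (cov v V) x - cov v (cov u V) x) (V x) = 0.
Proof.
move=> Ux sV.
pose p a b := inner H (f x) (cov a (cov b V) x) (V x).
pose q a b := inner H (f x) (cov b V x) (cov a V x).
have half a b :
    'D_a (fun y => 'D_b (fun z => inner H (f z) (V z) (V z)) y) x =
    2 * (p a b + q a b).
  have dVV y : U y -> 'D_b (fun z => inner H (f z) (V z) (V z)) y =
      2 * inner H (f y) (cov b V y) (V y).
    move=> Uy; apply: etrans (cov_metric b Uy sV sV) _.
    rewrite (innerC (Hsym (fU Uy)) (V y)).
    by rewrite mulr_natl mulr2n.
  have E1 := derive_ext oU Ux dVV a.
  have sc := smooth_pairing (smooth_cov b sV) sV.
  have E2 := deriveZ 2 (diff_derivable (v := a) (smooth_differentiable sc Ux)).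
  have E3 := cov_metric a Ux (smooth_cov b sV) sV.
  exact: etrans E1 (etrans E2 (congr1 _ E3)).
have E := derive_swap u v oU (smooth_pairing sV sV) Ux.
have {}E := etrans (esym (half u v)) (etrans E (half v u)).
have qC : q u v = q v u by apply: innerC; exact: Hsym (fU Ux).
apply: etrans (innerDl H (f x) _ _ _) _.
apply: etrans (congr1 _ (innerNl H (f x) _ _)) _.
suff : p u v - p v u = 0 by [].
by move: (p u v) (p v u) (q u v) (q v u) E qC => a b c d E qC; lra.
Qed.

End Pullback.

(** * The curvature tensor of a space form *)

Section CurvatureLike.
Context {R : realType} {E : zmodType}.
Variable Q : E -> E -> E -> E -> R.
Hypothesis Q1 : forall a a' b d w, Q (a + a') b d w = Q a b d w + Q a' b d w.
Hypothesis Q2 : forall a b b' d w, Q a (b + b') d w = Q a b d w + Q a b' d w.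
Hypothesis Q3 : forall a b d d' w, Q a b (d + d') w = Q a b d w + Q a b d' w.
Hypothesis Q4 : forall a b d w w', Q a b d (w + w') = Q a b d w + Q a b d w'.
Hypothesis Q12 : forall a b d w, Q a b d w = - Q b a d w.
Hypothesis Q34 : forall a b d w, Q a b d w = - Q a b w d.
Hypothesis bianchi : forall a b d w, Q a b d w + Q b d a w + Q d a b w = 0.
Hypothesis sectional0 : forall a b, Q a b b a = 0.

(** Polarization. The symmetries give the exchange symmetry of the two pairs;
    with it, the vanishing of Q a b b a makes Q alternating in its first and last
    arguments too, hence in all four. The cyclic sum is then 3 Q. *)
Lemma curvature_like_eq0 a b d w : Q a b d w = 0.
Proof.
have pair a' b' d' w' : Q a' b' d' w' = Q d' w' a' b'.
  have := (bianchi a' b' d' w', bianchi b' d' w' a').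
  have := (bianchi d' w' a' b', bianchi w' a' b' d').
  rewrite (Q12 d' a' b' w') (Q34 b' d' w' a') (Q34 d' w' b' a').
  rewrite (Q12 w' b' d' a') (Q34 b' w' d' a') (Q12 w' a' d' b').
  rewrite (Q34 a' w' d' b') (Q34 a' d' w' b') (Q12 w' a' b' d').
  by rewrite (Q34 a' b' w' d') => -[? ?] [? ?]; lra.
have skew14_diag a' b' d' : Q a' b' d' a' = 0.
  have := sectional0 a' (b' + d'); rewrite Q2 !Q3 !sectional0.
  have := pair a' b' d' a'; have := Q12 d' a' a' b'; have := Q34 a' d' a' b'.
  by move=> *; lra.
have skew14 a' b' d' w' : Q a' b' d' w' = - Q w' b' d' a'.
  have := skew14_diag (a' + w') b' d'; rewrite Q1 !Q4 !skew14_diag => *; lra.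
have cyc a' b' d' w' : Q b' d' a' w' = Q a' b' d' w'.
  rewrite skew14 Q12 opprK skew14 Q12 opprK Q34 skew14 opprK //.
have := bianchi a b d w; rewrite (cyc a b d) -(cyc d a b) => *; lra.
Qed.

End CurvatureLike.

(** The difference between the curvature form and its constant curvature model
    has the symmetries of a curvature form and vanishes on pairs: for independent
    vectors by hypothesis, for dependent ones by the symmetries. *)
Section ConstantCurvature.
Context {R : realType} {E : lmodType R}.
Variables (I : E -> E -> R) (Rm : E -> E -> E -> E) (c : R).
Hypothesis I_linear : forall w, linear (I^~ w : E -> R^o).
Hypothesis IC : forall u v, I u v = I v u.
Hypothesis I_pos : forall u, u != 0 -> 0 < I u u.
Hypothesis Rm_linear1 : forall b w, linear (fun a => Rm a b w).
Hypothesis Rm_linear3 : forall a b, linear (Rm a b).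
Hypothesis Rm_skew : forall a b w, Rm a b w = - Rm b a w.
Hypothesis Rm_bianchi : forall a b w, Rm a b w + Rm b w a + Rm w a b = 0.
Hypothesis Rm_skew_adjoint : forall a b w w', I (Rm a b w) w' = - I (Rm a b w') w.
Hypothesis sectional : forall u v, v != 0 -> (forall k : R, u != k *: v) ->
  I (Rm u v v) u / (I u u * I v v - I u v ^+ 2) = c.

Let ID u u' w : I (u + u') w = I u w + I u' w.
Proof. by have := I_linear w 1 u u'; rewrite !scale1r. Qed.
Let IDr u w w' : I u (w + w') = I u w + I u w'.
Proof. by rewrite IC ID !(IC _ u). Qed.
Let I0 w : I 0 w = 0.
Proof. by apply: (@addrI _ (I 0 w)); rewrite -ID !addr0. Qed.
Let IZ k u w : I (k *: u) w = k * I u w.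
Proof. by have := I_linear w k u 0; rewrite I0 !addr0. Qed.
Let IN u w : I (- u) w = - I u w.
Proof. by rewrite -scaleN1r IZ mulN1r. Qed.

Lemma constant_sectional_curvature a b d w :
  I (Rm a b d) w = c * (I b d * I a w - I a d * I b w).
Proof.
pose Q a b d w := I (Rm a b d) w - c * (I b d * I a w - I a d * I b w).
suff : Q a b d w = 0 by rewrite /Q; move=> /eqP; rewrite subr_eq0 => /eqP.
have Q12 a' b' d' w' : Q a' b' d' w' = - Q b' a' d' w'.
  by rewrite /Q Rm_skew IN; ring.
have Q34 a' b' d' w' : Q a' b' d' w' = - Q a' b' w' d'.
  by rewrite /Q Rm_skew_adjoint; ring.
have Q1 a1 a2 b' d' w' : Q (a1 + a2) b' d' w' = Q a1 b' d' w' + Q a2 b' d' w'.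
  rewrite /Q; have := Rm_linear1 b' d' 1 a1 a2; rewrite !scale1r => ->.
  by rewrite !ID; ring.
have Q3 a' b' d1 d2 w' : Q a' b' (d1 + d2) w' = Q a' b' d1 w' + Q a' b' d2 w'.
  rewrite /Q; have := Rm_linear3 a' b' 1 d1 d2; rewrite !scale1r => ->.
  by rewrite !ID !IDr; ring.
apply: curvature_like_eq0 => //.
- by move=> a' b1 b2 d' w'; rewrite Q12 Q1 opprD -!Q12.
- by move=> a' b' d' w1 w2; rewrite Q34 Q3 opprD -!Q34.
- move=> a' b' d' w'; rewrite /Q.
  have := congr1 (I^~ w') (Rm_bianchi a' b' d').
  rewrite /= !ID I0 (IC d' b') (IC d' a') (IC b' a') => e.
  lra.
move=> u v.
have Qdep k : Q (k *: v) v v (k *: v) = 0.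
  have rvv : Rm v v v = 0.
    have /eqP := Rm_skew v v v; rewrite -addr_eq0 -mulr2n -scaler_nat scaler_eq0.
    by rewrite pnatr_eq0 => /eqP.
  rewrite /Q; have -> : Rm (k *: v) v v = 0.
    have := Rm_linear1 v v k v (v - v); rewrite subrr addr0 => ->.
    have := Rm_linear1 v v (-1) v v; rewrite scaleN1r addNr => ->.
    by rewrite rvv !scaler0 !addr0.
  by rewrite I0 !IZ (IC v (k *: v)) IZ; ring.
have [v0|v0] := eqVneq v 0.
  have r0 : Rm u v 0 = 0.
    by have := Rm_linear3 u v (-1) 0 0; rewrite scaler0 addr0 scaleN1r addNr.
  by rewrite /Q v0 -{1}v0 r0 !(I0, IC u 0); ring.
have [[k uk]|uv] := pselect (exists k : R, u = k *: v).
  by rewrite uk; exact: Qdep.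
have {}uv k : u != k *: v by apply/eqP => uk; apply: uv; exists k.
have vv : 0 < I v v by apply: I_pos.
have den : I u u * I v v - I u v ^+ 2 != 0.
  apply/eqP => D0.
  have z0 : u - (I u v / I v v) *: v != 0 by rewrite subr_eq0.
  have := I_pos z0.
  rewrite ID !IDr !IN !IZ (IC u (- _)) (IC v (- _)) !IN !IZ (IC v u).
  move: (I u u) (I u v) (I v v) vv D0 => p q r r0 D0.
  have -> : p - q / r * q + (- (q / r * q) - q / r * - (q / r * r)) = (p * r - q ^+ 2) / r.
    by field; rewrite gt_eqF.
  by rewrite D0 mul0r ltxx.
have := sectional v0 uv => E1.
by rewrite /Q -[X in X - _](divfK den) E1 (IC v u); ring.
Qed.

End ConstantCurvature.

Lemma linear_sub_add_sub (R : realType) (E : lmodType R) (k : R)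
    (A A1 A2 B B1 B2 C C1 C2 D D1 D2 : E) :
  A = k *: A1 + A2 -> B = k *: B1 + B2 -> C = k *: C1 + C2 -> D = k *: D1 + D2 ->
  A - B + (C - D) = k *: (A1 - B1 + (C1 - D1)) + (A2 - B2 + (C2 - D2)).
Proof.
move=> -> -> -> ->; rewrite !scalerDr !scalerN !opprD.
by rewrite (addrACA _ A2 _ (- B2)) (addrACA _ C2 _ (- D2)) [LHS]addrACA.
Qed.

Lemma cyclic_sum_eq0 (Z : zmodType) (X Y W p p' q q' r r' s s' t t' u u' : Z) :
  X = p - q' + (s - t') -> Y = q - r' + (t - u') -> W = r - p' + (u - s') ->
  p' = p -> q' = q -> r' = r -> s' = s -> t' = t -> u' = u -> X + Y + W = 0.
Proof.
move=> -> -> -> -> -> -> -> -> ->.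
by rewrite [X in X + _]addrACA !subrKA [LHS]addrACA !subrKA !subrr addr0.
Qed.

Section CurvatureTensor.
Context {R : realType} {n : nat}.
Variables (H : 'rV[R]_n -> 'M[R]_n) (U : set 'rV[R]_n).
Hypothesis oU : open U.
Hypothesis sH : smooth_on U H.
Hypothesis Hsym : forall y, U y -> (H y)^T = H y.
Hypothesis Hpos : forall y, U y -> forall u, u != 0 -> 0 < inner H y u u.
Variable y : 'rV[R]_n.
Hypothesis Uy : U y.
Implicit Types a b d w : 'rV[R]_n.

Let dG b w : differentiable (fun z => Gamma H z b w) y.
Proof.
apply: smooth_differentiable Uy.
apply: (smooth_bilin_vec (Gamma_bilin H) oU (@smooth_id R _ U)
  (smooth_cst _ b) (smooth_cst _ w) (fun _ h => h) oU) => i j.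
exact: smooth_Gamma_basis.
Qed.

Let G := Gamma_bilin H y.

Lemma riem_skew a b w : riem H y a b w = - riem H y b a w.
Proof. by rewrite !riemE opprD !opprB. Qed.

Lemma riem_linear1 b w : linear (fun a => riem H y a b w).
Proof.
move=> k a a'.
have E1 : 'D_(k *: a + a') (fun z => Gamma H z b w) y =
   k *: 'D_a (fun z => Gamma H z b w) y + 'D_a' (fun z => Gamma H z b w) y.
  exact: etrans (derive_dirD _ _ (dG b w)) (congr1 (+%R^~ _) (derive_dirZ _ _ (dG b w))).
have E2 : 'D_b (fun z => Gamma H z (k *: a + a') w) y =
   k *: 'D_b (fun z => Gamma H z a w) y + 'D_b (fun z => Gamma H z a' w) y.
  have -> : (fun z => Gamma H z (k *: a + a') w) =
     (fun z => k *: Gamma H z a w + Gamma H z a' w).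
    apply/funext => z; exact: (Gamma_bilin H z).2.
  exact: derive_linear (dG a w) (dG a' w).
have E3 := G.2 (Gamma H y b w) k a a'.
have E4 := etrans (congr1 (Gamma H y b) (G.2 w k a a')) (G.1 _ _ _ _).
rewrite !riemE; exact: linear_sub_add_sub E1 E2 E3 E4.
Qed.

Lemma riem_linear3 a b : linear (fun w => riem H y a b w).
Proof.
move=> k w w'.
have E1 b' a' : 'D_b' (fun z => Gamma H z a' (k *: w + w')) y =
   k *: 'D_b' (fun z => Gamma H z a' w) y + 'D_b' (fun z => Gamma H z a' w') y.
  have -> : (fun z => Gamma H z a' (k *: w + w')) =
     (fun z => k *: Gamma H z a' w + Gamma H z a' w').
    apply/funext => z; exact: (Gamma_bilin H z).1.
  exact: derive_linear (dG a' w) (dG a' w').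
have E2 a' b' := etrans (congr1 (Gamma H y b') (G.1 a' k w w')) (G.1 _ _ _ _).
rewrite !riemE; exact: linear_sub_add_sub (E1 _ _) (E1 _ _) (E2 _ _) (E2 _ _).
Qed.

Lemma riem_bianchi a b w : riem H y a b w + riem H y b w a + riem H y w a b = 0.
Proof.
pose d a b w := 'D_a (fun z => Gamma H z b w) y.
pose g a b w := Gamma H y a (Gamma H y b w).
have dC a' b' w' : d a' b' w' = d a' w' b'.
  by apply: (derive_ext oU Uy) => z Uz; exact: (GammaC oU Hsym b' w' Uz).
have gC a' b' w' : g a' b' w' = g a' w' b'.
  exact: congr1 (GammaC oU Hsym b' w' Uy).
exact: cyclic_sum_eq0 (riemE H y a b w) (riemE H y b w a) (riemE H y w a b)
  (dC a w b) (dC b a w) (dC w b a) (gC a w b) (gC b a w) (gC w b a).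
Qed.

(** This is [cov_curvature_skew] along the identity map for a constant field,
    followed by polarization. *)
Lemma riem_inner_skew a b w w' :
  inner H y (riem H y a b w) w' = - inner H y (riem H y a b w') w.
Proof.
have diag v : inner H y (riem H y a b v) v = 0.
  have cs := smooth_cst U v.
  have := cov_curvature_skew oU oU sH Hsym Hpos (@smooth_id R _ U)
    (fun _ h => h) a b Uy cs.
  rewrite (cov_curvature oU oU sH Hpos (@smooth_id R _ U) (fun _ h => h) a b Uy cs).
  by rewrite !derive_id.
have := diag (w + w').
have := riem_linear3 a b 1 w w'; rewrite !scale1r => ->.
rewrite innerDl !innerDr !diag => *; lra.
Qed.

Variable c : R.
Hypothesis sectional_cst : forall u v, free [:: u; v] ->
  sectional_curvature H y u v = c.

Lemma riem_constant_curvature a b d w : inner H y (riem H y a b d) w =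
  c * (inner H y b d * inner H y a w - inner H y a d * inner H y b w).
Proof.
apply: (@constant_sectional_curvature _ _ (inner H y) (riem H y)) => //.
- exact: (inner_bilin H y).2.
- by move=> u v; apply: innerC; exact: Hsym.
- exact: Hpos.
- exact: riem_linear1.
- exact: riem_linear3.
- exact: riem_skew.
- exact: riem_bianchi.
- exact: riem_inner_skew.
move=> u v v0 uv; apply: sectional_cst.
rewrite free_cons span_seq1 seq1_free v0 andbT.
by apply/vlineP => -[k uk]; have := uv k; rewrite uk eqxx.
Qed.

End CurvatureTensor.

(** * Surfaces with constant principal curvatures *)

Section OrthogonalPair.
Context {R : realType}.
Variables (G : 'rV[R]_2 -> 'M[R]_2) (x : 'rV[R]_2).
Hypothesis Gsym : (G x)^T = G x.
Hypothesis Gpos : forall u, u != 0 -> 0 < inner G x u u.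
Implicit Types u v a : 'rV[R]_2.
Local Notation g := (inner G x).

Definition pair_fun (T : Type) (u v : T) (i : 'I_2) : T := if i == 0 then u else v.

Lemma pair_fun_orthogonal u v : g u v = 0 ->
  forall i j, i != j -> g (pair_fun u v i) (pair_fun u v j) = 0.
Proof.
move=> uv i j; rewrite /pair_fun.
case: i => [[|[|//]] ip]; case: j => [[|[|//]] jp] //= _.
by rewrite innerC.
Qed.

Lemma pair_fun_neq0 u v : u != 0 -> v != 0 -> forall i, pair_fun u v i != 0.
Proof. by move=> u0 v0 i; rewrite /pair_fun; case: ifP. Qed.

Lemma orthogonal_pair_expansion u v : u != 0 -> v != 0 -> g u v = 0 ->
  forall a, a = (g a u / g u u) *: u + (g a v / g v v) *: v.
Proof.
move=> u0 v0 uv a.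
have := orthogonal_basis_expansion Gpos (pair_fun_orthogonal uv)
  (pair_fun_neq0 u0 v0) a.
by rewrite big_ord_recl big_ord1.
Qed.

Lemma mtrace_orthogonal_pair (W : lmodType R) (b : 'rV[R]_2 -> 'rV[R]_2 -> W) u v :
  bilin b -> u != 0 -> v != 0 -> g u v = 0 ->
  mtrace G x b = (g u u)^-1 *: b u u + (g v v)^-1 *: b v v.
Proof.
move=> bb u0 v0 uv.
rewrite (mtrace_orthogonal Gpos (pair_fun_orthogonal uv) (pair_fun_neq0 u0 v0) bb).
by rewrite big_ord_recl big_ord1.
Qed.

(** In a G-orthogonal basis P, Q the vectors r P + Q and
    - <Q, Q> P + r <P, P> Q are always orthogonal, and their b-product is a
    quadratic polynomial in r whose discriminant is nonnegative since its extreme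
    coefficients have opposite signs. *)
Lemma simultaneous_diagonalization (b : 'rV[R]_2 -> 'rV[R]_2 -> R) :
  bilin (b : _ -> _ -> R^o) -> (forall u v, b u v = b v u) ->
  exists u v, [/\ u != 0, v != 0, g u v = 0 & b u v = 0].
Proof.
move=> bb bC.
have gC u v := innerC Gsym u v.
pose P : 'rV[R]_2 := basis_vec R 0.
pose Q : 'rV[R]_2 := basis_vec R 1 - (g (basis_vec R 1) P / g P P) *: P.
have P0 : P != 0.
  by apply/eqP => /rowP/(_ 0); rewrite !mxE !eqxx => /eqP; rewrite oner_eq0.
have Q0 : Q != 0.
  by apply/eqP => /rowP/(_ 1); rewrite !mxE /= mulr0 subr0 => /eqP; rewrite oner_eq0.
have gP := Gpos P0; have gQ := Gpos Q0.
have PQ : g P Q = 0.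
  rewrite /Q innerDr innerNr innerZr divfK ?gt_eqF // gC subrr //.
clearbody P Q; have [q0|q0] := eqVneq (b P Q) 0; first by exists P, Q.
pose A := g P P * b P Q; pose B := g P P * b Q Q - g Q Q * b P P.
pose s := Num.sqrt (B ^+ 2 + 4 * (g P P * g Q Q * b P Q ^+ 2)).
have sE : s ^+ 2 = B ^+ 2 + 4 * (g P P * g Q Q * b P Q ^+ 2).
  rewrite sqr_sqrtr // addr_ge0 ?sqr_ge0 // mulr_ge0 // mulr_ge0 ?sqr_ge0 //.
  by rewrite mulr_ge0 // ltW.
pose r := (s - B) / (2 * A).
have A0 : A != 0 by rewrite mulf_neq0 // gt_eqF.
exists (r *: P + Q), (- g Q Q *: P + (r * g P P) *: Q).
have guv : g (r *: P + Q) (- g Q Q *: P + (r * g P P) *: Q) = 0.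
  by rewrite innerDl !innerDr !innerZl !innerZr (gC Q P) PQ; ring.
split=> //.
- apply/eqP => u0; have := congr1 (g^~ Q) u0.
  by rewrite /= innerDl innerZl PQ inner0l mulr0 add0r => /eqP; rewrite gt_eqF.
- apply/eqP => v0; have := congr1 (g^~ P) v0.
  rewrite /= innerDl !innerZl (gC Q P) PQ inner0l mulr0 addr0 => /eqP.
  by rewrite mulf_eq0 oppr_eq0 !gt_eqF.
have bDl u u' v : b (u + u') v = b u v + b u' v by exact: (bilinDl bb).
have bDr u v v' : b u (v + v') = b u v + b u v' by exact: (bilinDr bb).
have bZl k u v : b (k *: u) v = k * b u v by exact: (bilinZl bb).
have bZr k u v : b u (k *: v) = k * b u v by exact: (bilinZr bb).
rewrite bDl !bDr !bZl !bZr (bC Q P).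
have -> : r * (- g Q Q * b P P) + r * (r * g P P * b P Q) +
   (- g Q Q * b P Q + r * g P P * b Q Q) =
   A * r ^+ 2 + B * r - g Q Q * b P Q by rewrite /A /B; ring.
have -> : A * r ^+ 2 + B * r - g Q Q * b P Q =
   (s ^+ 2 - B ^+ 2 - 4 * A * (g Q Q * b P Q)) / (4 * A).
  by rewrite /r; field.
by rewrite sE /A; apply/eqP; rewrite mulf_eq0; apply/orP; left; apply/eqP; ring.
Qed.

End OrthogonalPair.

(** The geometric core. U is a coordinate domain of the surface, I x the inner
    product of the ambient tangent space at the image of x, D the pull-back
    connection, fd w the image of the coordinate field w under the differential
    and T a normal field of constant square length t, which the tension field will
    provide. The two trace hypotheses say that the trace of the shape operator is
    t and that the trace of its square is 2 c t; the second one is what the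
    normal part of the biharmonic equation becomes. Everything about D that the
    argument uses is a hypothesis: in particular, the metric property enters only
    for pairs of fields whose inner product is constant. *)
Section Surface.
Context {R : realType} {E : lmodType R}.
Local Notation dir := 'rV[R]_2.
Local Notation field := (dir -> E).
Variables (U : set dir) (G : dir -> 'M[R]_2).
Variables (I : dir -> E -> E -> R) (Sm : field -> Prop).
Variables (D : dir -> field -> field) (fd : dir -> field) (T : field) (c t : R).

Hypothesis Gsym : forall x, U x -> (G x)^T = G x.
Hypothesis Gpos : forall x, U x -> forall u, u != 0 -> 0 < inner G x u u.

Hypothesis I_linear : forall x w, linear ((I x)^~ w : E -> R^o).
Hypothesis I_sym : forall x, U x -> forall u v, I x u v = I x v u.
Hypothesis I_pos : forall x, U x -> forall u, u != 0 -> 0 < I x u u.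

Hypothesis Sm_D : forall w V, Sm V -> Sm (D w V).
Hypothesis Sm_comb : forall k V W, Sm V -> Sm W -> Sm (fun x => V x + k *: W x).
Hypothesis Sm_fd : forall w, Sm (fd w).
Hypothesis Sm_T : Sm T.

Hypothesis D_comb : forall w k V W x, U x -> Sm V -> Sm W ->
  D w (fun x => V x + k *: W x) x = D w V x + k *: D w W x.
Hypothesis D_dir : forall V x, U x -> Sm V -> linear (fun w => D w V x).
Hypothesis fd_dir : forall x, U x -> linear (fun w => fd w x).
Hypothesis D_metric : forall k V W, Sm V -> Sm W ->
  (forall x, U x -> I x (V x) (W x) = k) ->
  forall x, U x -> forall w, I x (D w V x) (W x) + I x (V x) (D w W x) = 0.
Hypothesis D_torsion : forall u v x, U x -> D u (fd v) x = D v (fd u) x.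
Hypothesis D_curvature : forall u v V x, U x -> Sm V -> forall w,
  I x (D u (D v V) x - D v (D u V) x) w =
  c * (I x (fd v x) (V x) * I x (fd u x) w - I x (fd u x) (V x) * I x (fd v x) w).

Hypothesis isometric : forall x, U x -> forall u v,
  I x (fd u x) (fd v x) = inner G x u v.
Hypothesis T_normal : forall x, U x -> forall w, I x (T x) (fd w x) = 0.
Hypothesis T_norm : forall x, U x -> I x (T x) (T x) = t.
Hypothesis t_gt0 : 0 < t.
Hypothesis spanning : forall x, U x -> forall u v,
  u != 0 -> v != 0 -> inner G x u v = 0 -> forall z,
  I x z (fd u x) = 0 -> I x z (fd v x) = 0 -> I x z (T x) = 0 -> z = 0.

Hypothesis trace_shape : forall x, U x -> forall u v,
  u != 0 -> v != 0 -> inner G x u v = 0 ->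
  - (I x (D u T x) (fd u x) / inner G x u u + I x (D v T x) (fd v x) / inner G x v v)
  = t.
Hypothesis trace_shape2 : forall x, U x -> forall u v,
  u != 0 -> v != 0 -> inner G x u v = 0 ->
  I x (D u T x) (D u T x) / inner G x u u + I x (D v T x) (D v T x) / inner G x v v
  = 2 * c * t.

Let ID x u u' w : I x (u + u') w = I x u w + I x u' w.
Proof. by have := I_linear x w 1 u u'; rewrite !scale1r. Qed.
Let I0 x w : I x 0 w = 0.
Proof. by apply: (@addrI _ (I x 0 w)); rewrite -ID !addr0. Qed.
Let IZ x k u w : I x (k *: u) w = k * I x u w.
Proof. by have := I_linear x w k u 0; rewrite I0 !addr0. Qed.
Let IDr x : U x -> forall u w w', I x u (w + w') = I x u w + I x u w'.
Proof. by move=> Ux u w w'; rewrite I_sym // ID !(I_sym Ux u). Qed.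
Let IZr x : U x -> forall k u w, I x u (k *: w) = k * I x u w.
Proof. by move=> Ux k u w; rewrite I_sym // IZ (I_sym Ux u). Qed.
Let I0r x : U x -> forall u, I x u 0 = 0.
Proof. by move=> Ux u; rewrite I_sym. Qed.

(** The second fundamental form paired with T, in the form given by the Weingarten
    equation. *)
Let b x u w := - I x (D u T x) (fd w x).

(** Differentiate <T, fd w> = 0. *)
Lemma D_fd_T x u w : U x -> I x (T x) (D u (fd w) x) = b x u w.
Proof.
move=> Ux; have := D_metric Sm_T (Sm_fd w) (fun y Uy => T_normal Uy w) Ux u.
by rewrite /b => /eqP; rewrite addrC addr_eq0 => /eqP.
Qed.

Lemma shape_sym x u w : U x -> b x u w = b x w u.
Proof. by move=> Ux; rewrite -!D_fd_T // D_torsion. Qed.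

Lemma DT_T x u : U x -> I x (D u T x) (T x) = 0.
Proof.
move=> Ux; have := D_metric Sm_T Sm_T T_norm Ux u.
by rewrite (I_sym Ux (T x)) => /eqP; rewrite -mulr2n mulrn_eq0 => /eqP.
Qed.

Lemma shape_bilin x : U x -> bilin (b x : _ -> _ -> R^o).
Proof.
move=> Ux; split=> [u k v v'|v k u u']; rewrite /b.
  by rewrite (fd_dir Ux) IDr // IZr // opprD -mulrN.
by rewrite /= (D_dir Ux Sm_T) ID IZ opprD -mulrN.
Qed.

(** The numbers l and m are the principal curvatures multiplied by the length of
    T, since T is not normalized. *)
Definition principal_frame x u v l m :=
  [/\ u != 0, v != 0, inner G x u v = 0,
    D u T x = - l *: fd u x & D v T x = - m *: fd v x].

(** Diagonalize the second fundamental form with respect to the metric. The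
    derivative of T is tangent because T has constant length, so each vector of
    the frame is an eigenvector of the shape operator, and the two trace
    hypotheses become the two equations. *)
Lemma principal_frame_exists x : U x -> exists u v l m,
  [/\ principal_frame x u v l m, l + m = t & l ^+ 2 + m ^+ 2 = 2 * c * t].
Proof.
move=> Ux.
have [u [v [u0 v0 guv buv]]] := simultaneous_diagonalization (Gsym Ux) (Gpos Ux)
  (shape_bilin Ux) (fun u v => shape_sym u v Ux).
have gC := innerC (Gsym Ux).
have eigen a a' : a != 0 -> a' != 0 -> inner G x a a' = 0 -> b x a a' = 0 ->
    D a T x = - (b x a a / inner G x a a) *: fd a x.
  move=> a0 a'0 gaa' baa'; have ga := Gpos Ux a0.
  apply/eqP; rewrite -subr_eq0 scaleNr opprK; apply/eqP.
  apply: (spanning Ux a0 a'0 gaa'); rewrite ID IZ.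
  - by rewrite (isometric Ux) divfK ?gt_eqF // /b addrN.
  - rewrite (isometric Ux) gaa' mulr0 addr0; apply/eqP.
    by rewrite -oppr_eq0; apply/eqP.
  - by rewrite DT_T // (I_sym Ux) T_normal // mulr0 addr0.
exists u, v, (b x u u / inner G x u u), (b x v v / inner G x v v).
have Eu := eigen u v u0 v0 guv buv.
have Ev : D v T x = - (b x v v / inner G x v v) *: fd v x.
  by apply: eigen u0 _ _ => //; [rewrite gC | rewrite shape_sym].
split; first by split.
- by rewrite -(trace_shape Ux u0 v0 guv) /b !mulNr opprD.
have gu := Gpos Ux u0; have gv := Gpos Ux v0.
have := trace_shape2 Ux u0 v0 guv; rewrite {1 2}Eu {1 2}Ev !IZ !IZr // !(isometric Ux).
move=> <-; move: (b x u u) (b x v v) (inner G x u u) (inner G x v v) gu gv.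
by move=> p q r s r0 s0; field; rewrite !gt_eqF.
Qed.

(** The principal curvatures are determined by their sum and their sum of
    squares, hence are the same constants l and m at every point. If they differ,
    the fields F w = D w T + m fd w and N w = D w T + l fd w point along the first
    and the second principal direction. The Codazzi equation says that F and N are
    closed one-forms with values in the ambient bundle, and this forces both
    principal line fields to be parallel in the surface, so that the surface is
    flat; the Gauss equation then gives l m = - c t, which contradicts the sum
    rules. *)
Section DistinctPrincipalCurvatures.
Variables l m : R.
Hypothesis lm : l != m.
Hypothesis sum_lm : l + m = t.
Hypothesis sum2_lm : l ^+ 2 + m ^+ 2 = 2 * c * t.

Lemma distinct_frame x : U x -> exists u v, principal_frame x u v l m.
Proof.
move=> Ux.
have [u [v [l' [m' [[u0 v0 guv Eu Ev] s1 s2]]]]] := principal_frame_exists Ux.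
have : (l' - l) * (l' - m) == 0.
  (* The two sums determine the product, hence the unordered pair. *)
  have p : l' * m' = l * m.
    have : (l' + m') ^+ 2 - (l' ^+ 2 + m' ^+ 2) = (l + m) ^+ 2 - (l ^+ 2 + m ^+ 2).
      by rewrite s1 s2 sum_lm sum2_lm.
    by rewrite !sqrrD => e; lra.
  have m'E : m' = l + m - l' by rewrite sum_lm -s1; ring.
  by apply/eqP; move: p; rewrite m'E => e; lra.
rewrite mulf_eq0 !subr_eq0 => /orP[/eqP l'E|/eqP l'E].
  exists u, v; have -> : m = m' by apply: (@addrI _ l); rewrite sum_lm -s1 l'E.
  by rewrite -l'E.
exists v, u; have -> : l = m' by apply: (@addrI _ m); rewrite addrC sum_lm -s1 l'E.
by split=> //; [rewrite innerC //; exact: Gsym | rewrite -l'E].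
Qed.

Let F w : field := fun x => D w T x + m *: fd w x.
Let N w : field := fun x => D w T x + l *: fd w x.

Let Sm_F w : Sm (F w). Proof. by apply: Sm_comb => //; exact: Sm_D. Qed.
Let Sm_N w : Sm (N w). Proof. by apply: Sm_comb => //; exact: Sm_D. Qed.

(** The Codazzi equation: in a space form the curvature of two tangent vectors
    annihilates normal vectors. *)
Lemma curvature_T u v x : U x -> D u (D v T) x = D v (D u T) x.
Proof.
move=> Ux; apply/eqP; rewrite -subr_eq0; apply/negPn/negP => /(I_pos Ux).
rewrite D_curvature // !(I_sym Ux (fd _ x) (T x)) !T_normal // !mul0r subrr mulr0.
by rewrite ltxx.
Qed.

Lemma F_closed u v x : U x -> D u (F v) x = D v (F u) x.
Proof.
move=> Ux; rewrite /F !D_comb //; try exact: Sm_D.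
by rewrite curvature_T // D_torsion.
Qed.

Lemma N_closed u v x : U x -> D u (N v) x = D v (N u) x.
Proof.
move=> Ux; rewrite /N !D_comb //; try exact: Sm_D.
by rewrite curvature_T // D_torsion.
Qed.

Section AtPoint.
Variables (x u v : dir).
Hypothesis Ux : U x.
Hypothesis frame : principal_frame x u v l m.

Let u0 : u != 0. Proof. by have [] := frame. Qed.
Let v0 : v != 0. Proof. by have [] := frame. Qed.
Let guv : inner G x u v = 0. Proof. by have [] := frame. Qed.

Lemma F_principal : F u x = (m - l) *: fd u x.
Proof. by have [_ _ _ E1 _] := frame; rewrite /F E1 -scalerDl addrC. Qed.
Lemma F_kernel : F v x = 0.
Proof. by have [_ _ _ _ E2] := frame; rewrite /F E2 -scalerDl addNr scale0r. Qed.
Lemma N_kernel : N u x = 0.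
Proof. by have [_ _ _ E1 _] := frame; rewrite /N E1 -scalerDl addNr scale0r. Qed.
Lemma N_principal : N v x = (l - m) *: fd v x.
Proof. by have [_ _ _ _ E2] := frame; rewrite /N E2 -scalerDl addrC. Qed.

Let ku a := inner G x a u / inner G x u u.
Let kv a := inner G x a v / inner G x v v.

Let aE a : a = ku a *: u + kv a *: v.
Proof. exact: (orthogonal_pair_expansion (Gsym Ux) (Gpos Ux) u0 v0 guv). Qed.

Let fd0 : fd 0 x = 0.
Proof. by apply: (@addrI _ (fd 0 x)); have := fd_dir Ux 1 0 0; rewrite !scale1r !addr0. Qed.

Let D_dirE V a : Sm V -> D a V x = ku a *: D u V x + kv a *: D v V x.
Proof.
move=> sV; rewrite {1}(aE a) (D_dir Ux sV).
have D0 : D 0 V x = 0.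
  by apply: (@addrI _ (D 0 V x)); have := D_dir Ux sV 1 0 0; rewrite !scale1r !addr0.
by have := D_dir Ux sV (kv a) v 0; rewrite D0 !addr0 => ->.
Qed.

Let fd_dirE a : fd a x = ku a *: fd u x + kv a *: fd v x.
Proof.
rewrite {1}(aE a) (fd_dir Ux).
by have := fd_dir Ux (kv a) v 0; rewrite fd0 !addr0 => ->.
Qed.

Lemma F_rank1 a : F a x = ku a *: F u x.
Proof.
transitivity (ku a *: F u x + kv a *: F v x); last by rewrite F_kernel scaler0 addr0.
by rewrite /F D_dirE // fd_dirE !scalerDr !scalerA [LHS]addrACA !(mulrC m).
Qed.

Lemma N_rank1 a : N a x = kv a *: N v x.
Proof.
transitivity (ku a *: N u x + kv a *: N v x); last by rewrite N_kernel scaler0 add0r.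
by rewrite /N D_dirE // fd_dirE !scalerDr !scalerA [LHS]addrACA !(mulrC l).
Qed.

Lemma F_N_orthogonal_at a a' : I x (F a x) (N a' x) = 0.
Proof. by rewrite F_rank1 N_rank1 F_principal N_principal !IZ !IZr // (isometric Ux) guv !mulr0. Qed.

End AtPoint.

Lemma F_N_orthogonal x a a' : U x -> I x (F a x) (N a' x) = 0.
Proof. by move=> Ux; have [u [v fr]] := distinct_frame Ux; exact: F_N_orthogonal_at fr _ _. Qed.

Lemma F_T_orthogonal x a : U x -> I x (F a x) (T x) = 0.
Proof. by move=> Ux; rewrite ID IZ DT_T // (I_sym Ux) T_normal // mulr0 addr0. Qed.

Lemma N_T_orthogonal x a : U x -> I x (N a x) (T x) = 0.
Proof. by move=> Ux; rewrite ID IZ DT_T // (I_sym Ux) T_normal // mulr0 addr0. Qed.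

Let C x w a a' := I x (D w (F a) x) (N a' x).

Let C_alt x w a a' : U x -> C x w a a' = - I x (F a x) (D w (N a') x).
Proof.
move=> Ux; have := D_metric (Sm_F a) (Sm_N a') (fun y => @F_N_orthogonal y a a') Ux w.
by move=> /eqP; rewrite addr_eq0 => /eqP.
Qed.

Let C12 x w a a' : U x -> C x w a a' = C x a w a'.
Proof. by move=> Ux; rewrite /C F_closed. Qed.

Let C13 x w a a' : U x -> C x w a a' = C x a' a w.
Proof. by move=> Ux; rewrite !C_alt // N_closed. Qed.

(** The trilinear form C w a a' = <D w (F a), N a'> is symmetric in w and a
    because F is closed and, since F is orthogonal to N, it is symmetric in w and
    a' because N is closed. It vanishes when its last argument is the first vector
    u of the principal frame, where N vanishes; the symmetries reduce every value
    to this case, because F w and N w are multiples of F u and N v. *)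
Lemma DF_N_orthogonal x w a a' : U x -> I x (D w (F a) x) (N a' x) = 0.
Proof.
move=> Ux; have [u [v fr]] := distinct_frame Ux.
rewrite -/(C x w a a').
have Cu w' a1 : C x w' a1 u = 0 by rewrite /C (N_kernel fr) I0r.
rewrite C_alt // (F_rank1 Ux fr) IZ -mulrN -C_alt // /C (N_rank1 Ux fr) IZr // -/(C x w u v).
suff -> : C x w u v = 0 by rewrite !mulr0.
by rewrite C12 // C_alt // (F_rank1 Ux fr w) IZ -mulrN -C_alt // C13 // Cu mulr0.
Qed.

(** Differentiating <D w (F u), N v> = 0 once more and antisymmetrizing in the
    two directions of derivation expresses the curvature of the ambient space
    through inner products of first derivatives of F and N. At a point of the
    surface these only have a normal component in common, which the shape operator
    determines; the result is the Gauss equation for curvature zero. *)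
Lemma distinct_principal_curvatures_absurd x : ~ U x.
Proof.
move=> Ux; have [u [v fr]] := distinct_frame Ux.
have [u0 v0 guv Eu Ev] := fr.
have gu := Gpos Ux u0; have gv := Gpos Ux v0.
have DFN0 w a a' : forall y, U y -> I y (D w (F a) y) (N a' y) = 0.
  by move=> y; exact: DF_N_orthogonal.
have e1 := D_metric (Sm_D u (Sm_F u)) (Sm_N v) (@DFN0 u u v) Ux v.
have e2 := D_metric (Sm_D v (Sm_F u)) (Sm_N v) (@DFN0 v u v) Ux u.
have e3 := D_curvature v u Ux (Sm_F u) (N v x).
have lm0 : l - m != 0 by rewrite subr_eq0.
have DFv w a : I x (D w (F a) x) (fd v x) = 0.
  have := DF_N_orthogonal w a v Ux; rewrite (N_principal fr) IZr // => /eqP.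
  by rewrite mulf_eq0 (negPf lm0) => /eqP.
have DNu w a : I x (D w (N a) x) (fd u x) = 0.
  have := C_alt w u a Ux; rewrite /C DF_N_orthogonal // (F_principal fr) IZ => /esym/eqP.
  rewrite oppr_eq0 mulf_eq0 subr_eq0 eq_sym (negPf lm) /= => /eqP.
  by rewrite (I_sym Ux).
have DFT w a : I x (D w (F a) x) (T x) = - I x (F a x) (D w T x).
  have := D_metric (Sm_F a) Sm_T (fun y => @F_T_orthogonal y a) Ux w.
  by move=> /eqP; rewrite addr_eq0 => /eqP.
have DNT w a : I x (D w (N a) x) (T x) = - I x (N a x) (D w T x).
  have := D_metric (Sm_N a) Sm_T (fun y => @N_T_orthogonal y a) Ux w.
  by move=> /eqP; rewrite addr_eq0 => /eqP.
(* [DFv] and [DNu] leave no common tangential component, and the components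
   along T are known from <F a, T> = 0 and <N a, T> = 0. *)
have normal w a w' a' : I x (D w (F a) x) (D w' (N a') x) =
    I x (F a x) (D w T x) * I x (N a' x) (D w' T x) / t.
  have zE : D w (F a) x = (I x (D w (F a) x) (fd u x) / inner G x u u) *: fd u x
     + (I x (D w (F a) x) (T x) / t) *: T x.
    apply/subr0_eq/(spanning Ux u0 v0 guv).
    - rewrite ID -scaleN1r IZ ID !IZ (isometric Ux) T_normal // divfK ?gt_eqF //.
      by rewrite mulr0 addr0 mulN1r subrr.
    - rewrite ID -scaleN1r IZ ID !IZ (isometric Ux) T_normal // guv DFv.
      by rewrite !mulr0 addr0 mulr0 addr0.
    rewrite ID -scaleN1r IZ ID !IZ (I_sym Ux (fd u x)) T_normal // T_norm //.
    by rewrite divfK ?gt_eqF // mulr0 add0r mulN1r subrr.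
  rewrite zE ID !IZ (I_sym Ux (fd u x)) DNu mulr0 add0r (I_sym Ux (T x)).
  by rewrite DFT DNT; field; rewrite gt_eqF.
have IN1 z w : I x (z - w) (N v x) = I x z (N v x) - I x w (N v x).
  by rewrite ID -scaleN1r IZ mulN1r.
have gvu : inner G x v u = 0 by rewrite innerC //; exact: Gsym.
move: e1 e2 e3; rewrite !normal IN1 (F_principal fr) (N_principal fr) Eu Ev.
rewrite !IZ !IZr // !(isometric Ux) guv gvu !mulr0 !mul0r !addr0 subr0.
move: (I x _ _) (I x _ _) => X Y.
set g1 := inner G x u u in gu *; set g2 := inner G x v v in gv *.
clearbody g1 g2; move=> e1 e2 e3.
(* The Gauss equation c + l * m / t = 0; recall that |T|^2 = t. *)
have lmE : l * m = - (c * t).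
  apply: (@mulfI _ ((l - m) ^+ 2 * (g1 * g2) / t)).
    by rewrite !mulf_neq0 ?invr_neq0 ?expf_neq0 // gt_eqF.
  have -> : (l - m) ^+ 2 * (g1 * g2) / t * - (c * t) =
      - c * ((l - m) ^+ 2 * (g1 * g2)) by field; rewrite gt_eqF.
  by move: e1 e2 e3; rewrite ?mul0r ?mulr0 ?addr0; move: (t^-1) => ti e1 e2 e3; lra.
have : t ^+ 2 = 0.
  rewrite -sum_lm sqrrD mulr2n lmE.
  by have := sum2_lm => e; lra.
by move=> /eqP; rewrite sqrf_eq0 gt_eqF.
Qed.

End DistinctPrincipalCurvatures.

Theorem shape_half_trace_of_traces x : U x -> forall u w,
  - I x (D u T x) (fd w x) = t / 2 * inner G x u w.
Proof.
move=> Ux a w.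
have [u [v [l [m [fr s1 s2]]]]] := principal_frame_exists Ux.
have [lm|lm] := eqVneq l m; last first.
  by have := distinct_principal_curvatures_absurd lm s1 s2 Ux.
have [u0 v0 guv Eu Ev] := fr.
have lE : l = t / 2 by rewrite -s1 -lm; field.
have bE a' : a' = u \/ a' = v -> b x a' w = l * inner G x a' w.
  move=> e; rewrite /b; have -> : D a' T x = - l *: fd a' x.
    by case: e => -> //; rewrite Ev lm.
  by rewrite IZ mulNr opprK isometric.
rewrite -/(b x a w) -lE.
rewrite (orthogonal_pair_expansion (Gsym Ux) (Gpos Ux) u0 v0 guv a).
move: (_ / _) (_ / _) => ku kv.
have bb := shape_bilin Ux.
rewrite (bilinDl bb) (bilinZl bb) (bilinZl bb) innerDl !innerZl.
rewrite !bE; [|by right|by left].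
by rewrite /GRing.scale /=; ring.
Qed.

End Surface.

(** * Isometric immersions in charts *)

Section IsometricImmersion.
Context {R : realType} {m n : nat}.
Variables (U : set 'rV[R]_m) (U' : set 'rV[R]_n).
Variables (G : 'rV[R]_m -> 'M[R]_m) (H : 'rV[R]_n -> 'M[R]_n).
Variable f : 'rV[R]_m -> 'rV[R]_n.
Hypotheses (oU : open U) (oU' : open U').
Hypothesis sG : smooth_on U G.
Hypothesis Gsym : forall x, U x -> (G x)^T = G x.
Hypothesis Gpos : forall x, U x -> forall u, u != 0 -> 0 < inner G x u u.
Hypothesis sH : smooth_on U' H.
Hypothesis Hsym : forall y, U' y -> (H y)^T = H y.
Hypothesis Hpos : forall y, U' y -> forall u, u != 0 -> 0 < inner H y u u.
Hypothesis sf : smooth_on U f.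
Hypothesis fU : forall x, U x -> U' (f x).
Hypothesis isom : forall x, U x -> forall u v,
  inner H (f x) ('D_u f x) ('D_v f x) = inner G x u v.
Implicit Types (x u v w : 'rV[R]_m).

Local Notation cov w V := (pnabla H f (cst w) V).
Local Notation fd w := (fun y => 'D_w f y).
Local Notation hess u v x := (nabla_df G H f (cst u) (cst v) x).
Local Notation T := (tension G H f).

Let df x : U x -> differentiable f x.
Proof. exact: smooth_differentiable. Qed.

Lemma fd_linear x : U x -> linear (fun w => 'D_w f x).
Proof.
move=> Ux a u v.
exact: etrans (derive_dirD _ _ (df Ux)) (congr1 (+%R^~ _) (derive_dirZ _ _ (df Ux))).
Qed.

Lemma cov_dir_linear V x : U x -> smooth_on U V -> linear (fun w => cov w V x).
Proof.
move=> Ux sV a u v.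
exact: etrans (cov_dirD H sf _ _ Ux sV) (congr1 (+%R^~ _) (cov_dirZ H sf _ _ Ux sV)).
Qed.

Lemma cov_comb w (k : R) V W x : U x -> smooth_on U V -> smooth_on U W ->
  cov w (fun y => V y + k *: W y) x = cov w V x + k *: cov w W x.
Proof.
move=> Ux sV sW.
have skW : smooth_on U (fun y => k *: W y).
  by apply: (smooth_mxZ oU) => //; exact: smooth_cst.
exact: etrans (covD H f _ Ux sV skW) (congr1 _ (covZ H f _ _ Ux sW)).
Qed.

Lemma nabla_dfE u v x : hess u v x = cov u (fd v) x - 'D_(Gamma G x u v) f x.
Proof.
have nE : nabla G (cst u) (cst v) x = Gamma G x u v.
  by rewrite /nabla derive_cst add0r.
exact (congr1 (fun z => cov u (fd v) x - 'D_z f x) nE).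
Qed.

(** The Koszul formula on the surface and the metric property along f compute
    the same number: the derivatives of the induced metric
    <D_v f, D_w f> determine both the tangential part of the covariant derivative
    of D_v f and the Christoffel symbols of the surface. *)
Lemma nabla_df_normal u v w x : U x -> inner H (f x) (hess u v x) ('D_w f x) = 0.
Proof.
move=> Ux.
pose K a b c := inner H (f x) (cov a (fd b) x) ('D_c f x).
have dg a b c : 'D_a (fun y => inner G y b c) x = K a b c + K a c b.
  have sb := smooth_derive b sf; have sc := smooth_derive c sf.
  have E1 := derive_ext oU Ux (fun y Uy => esym (isom Uy b c)) a.
  have E2 := cov_metric oU' sH Hsym Hpos sf fU a Ux sb sc.
  have E3 := innerC (Hsym (fU Ux)) ('D_b f x) (cov a (fd c) x).
  exact: etrans E1 (etrans E2 (congr1 _ E3)).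
have KC a b c : K a b c = K b a c.
  by rewrite /K (cov_torsion oU oU' Hsym sf fU a b Ux).
rewrite nabla_dfE.
apply: etrans (innerDl H (f x) _ _ _) _.
apply: etrans (congr1 _ (innerNl H (f x) _ _)) _.
apply/eqP; rewrite subr_eq0; apply/eqP.
apply: etrans _ (esym (isom Ux _ _)).
apply: etrans _ (esym (inner_Gamma oU sG Gsym Gpos u v w Ux)).
rewrite (dg u v w) (dg v u w) (dg w u v) -/(K u v w).
rewrite (KC v u w) (KC w u v) (KC v w u).
move: (K u v w) (K u w v) (K w v u) => p q r; lra.
Qed.

Lemma tension_normal w x : U x -> inner H (f x) (T x) ('D_w f x) = 0.
Proof.
move=> Ux.
have Il : linear ((inner H (f x))^~ ('D_w f x) : _ -> R^o) := (inner_bilin H (f x)).2 _.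
apply: etrans (mtrace_map _ _ _ Il) _.
rewrite /mtrace big1 // => i _; rewrite big1 // => j _.
by rewrite (nabla_df_normal _ _ _ Ux) scaler0.
Qed.

Lemma smooth_tension : smooth_on U T.
Proof.
apply: (smooth_mx_sum oU) => i; apply: (smooth_mx_sum oU) => j.
apply: (smooth_mxZ oU).
  apply: (smooth_invmx oU) => [i' j'|x Ux]; first exact: smooth_entry.
  by apply: posdef_unitmx; exact: Gpos.
pose e := @basis_vec R m.
apply: (smooth_on_ext oU (f := fun x => cov (e i) (fd (e j)) x +
   \sum_k (- christoffel G x k i j) *: 'D_(e k) f x)).
  move=> x Ux; rewrite nabla_dfE.
  have -> : 'D_(Gamma G x (e i) (e j)) f x =
      \sum_k christoffel G x k i j *: 'D_(e k) f x.
    rewrite (deriveE _ (df Ux)) (row_basis_sum (Gamma G x (e i) (e j))) linear_sum.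
    apply: eq_bigr => k _.
    by rewrite linearZ /= Gamma_basis -(deriveE _ (df Ux)).
  congr (_ + _); rewrite -sumrN; apply: eq_bigr => k _; exact: scaleNr.
apply: (smooth_mxD oU).
  exact: (smooth_cov oU oU' sH Hpos sf fU _ (smooth_derive _ sf)).
apply: (smooth_mx_sum oU) => k; apply: (smooth_mxZ oU); last exact: smooth_derive.
by apply: (smoothN oU); exact: (smooth_christoffel oU sG Gpos).
Qed.

(** The Weingarten relation: differentiate <T, D_v f> = 0; the Christoffel term
    of the surface is tangent and drops out. *)
Lemma inner_tension_nabla_df u v x : U x ->
  inner H (f x) (T x) (hess u v x) = - inner H (f x) (cov u T x) ('D_v f x).
Proof.
move=> Ux; rewrite nabla_dfE.
have E1 : inner H (f x) (T x) (cov u (fd v) x - 'D_(Gamma G x u v) f x) =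
    inner H (f x) (T x) (cov u (fd v) x).
  apply: etrans (innerDr H (f x) _ _ _) _.
  apply: etrans (congr1 _ (innerNr H (f x) _ _)) _.
  by rewrite (tension_normal _ Ux) subr0.
apply: etrans E1 _.
have E2 := cov_metric oU' sH Hsym Hpos sf fU u Ux smooth_tension (smooth_derive v sf).
have E3 : 'D_u (fun y => inner H (f y) (T y) ('D_v f y)) x = 0.
  apply: etrans (derive_ext (g := cst 0) oU Ux _ u) (derive_cst _ _ _).
  by move=> y Uy; exact: tension_normal.
have /eqP E4 := etrans (esym E2) E3.
by apply/eqP; rewrite -addr_eq0 addrC.
Qed.

Lemma inner_tension_tension x : U x -> inner H (f x) (T x) (T x) =
  mtrace G x (fun u v => - inner H (f x) (cov u T x) ('D_v f x) : R^o).
Proof.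
move=> Ux.
have Il : linear (inner H (f x) (T x) : _ -> R^o) := (inner_bilin H (f x)).1 _.
apply: etrans (mtrace_map _ _ _ Il) _.
by apply: eq_mtrace => u v; exact: inner_tension_nabla_df.
Qed.

End IsometricImmersion.

(** * Biharmonic surfaces in a three-dimensional space form *)

Lemma pnabla_pointwise (R : realType) m n (H : 'rV[R]_n -> 'M[R]_n)
    (f : 'rV[R]_m -> 'rV[R]_n) X V x :
  pnabla H f X V x = pnabla H f (cst (X x)) V x.
Proof. by []. Qed.

Lemma orthogonal_triple_eq0 (R : realType) (H : 'rV[R]_3 -> 'M[R]_3) y :
  (H y)^T = H y -> (forall u, u != 0 -> 0 < inner H y u u) ->
  forall p q r, p != 0 -> q != 0 -> r != 0 ->
  inner H y p q = 0 -> inner H y r p = 0 -> inner H y r q = 0 ->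
  forall z, inner H y z p = 0 -> inner H y z q = 0 -> inner H y z r = 0 -> z = 0.
Proof.
move=> Hsym Hpos p q r p0 q0 r0 pq rp rq z zp zq zr.
pose P (i : 'I_3) := match nat_of_ord i with 0%N => p | 1%N => q | _ => r end.
apply: (@orthogonal_basis_eq0 _ _ H y Hpos P).
- by case=> [[|[|[|//]]] ip]; case=> [[|[|[|//]]] jp] //= _; rewrite /P /= // innerC.
- by case=> [[|[|[|//]]] ip].
- by case=> [[|[|[|//]]] ip].
Qed.

(** When the tension field T has constant length, its covariant derivatives are
    orthogonal to it. In the normal component of the bitension field this removes
    the Christoffel terms of the surface and turns the Laplacian of T into minus
    the squared norm of its derivative, while the curvature term is that of a space
    form. *)
Section ConstantTension.
Context {R : realType} {m n : nat}.
Variables (U : set 'rV[R]_m) (U' : set 'rV[R]_n).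
Variables (G : 'rV[R]_m -> 'M[R]_m) (H : 'rV[R]_n -> 'M[R]_n).
Variable f : 'rV[R]_m -> 'rV[R]_n.
Hypotheses (oU : open U) (oU' : open U').
Hypothesis sG : smooth_on U G.
Hypothesis Gsym : forall x, U x -> (G x)^T = G x.
Hypothesis Gpos : forall x, U x -> forall u, u != 0 -> 0 < inner G x u u.
Hypothesis sH : smooth_on U' H.
Hypothesis Hsym : forall y, U' y -> (H y)^T = H y.
Hypothesis Hpos : forall y, U' y -> forall u, u != 0 -> 0 < inner H y u u.
Hypothesis sf : smooth_on U f.
Hypothesis fU : forall x, U x -> U' (f x).
Hypothesis isom : forall x, U x -> forall u v,
  inner H (f x) ('D_u f x) ('D_v f x) = inner G x u v.
Variables c t : R.
Hypothesis curv : forall y, U' y -> forall u v, free [:: u; v] ->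
  sectional_curvature H y u v = c.
Local Notation cov w V := (pnabla H f (cst w) V).
Local Notation T := (tension G H f).
Hypothesis T_norm : forall x, U x -> inner H (f x) (T x) (T x) = t.

Let sT : smooth_on U T.
Proof. exact: (smooth_tension oU oU' sG Gpos sH Hpos sf fU). Qed.

Lemma cov_metric_cst (k : R) V W : smooth_on U V -> smooth_on U W ->
  (forall x, U x -> inner H (f x) (V x) (W x) = k) -> forall x, U x -> forall w,
  inner H (f x) (cov w V x) (W x) + inner H (f x) (V x) (cov w W x) = 0.
Proof.
move=> sV sW VWk x Ux w.
have E := cov_metric oU' sH Hsym Hpos sf fU w Ux sV sW.
exact: etrans (esym E) (etrans (derive_ext (g := cst k) oU Ux VWk w) (derive_cst _ _ _)).
Qed.

Lemma cov_tension_tension w x : U x -> inner H (f x) (cov w T x) (T x) = 0.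
Proof.
move=> Ux; have := cov_metric_cst sT sT T_norm Ux w.
rewrite (innerC (Hsym (fU Ux)) (T x)) => /eqP.
by rewrite -mulr2n mulrn_eq0 => /eqP.
Qed.

Lemma inner_bitension_tension x : U x ->
  inner H (f x) (bitension G H f x) (T x) =
  mtrace G x (fun u v => c * t * inner G x u v
                         - inner H (f x) (cov u T x) (cov v T x) : R^o).
Proof.
move=> Ux.
have Il : linear ((inner H (f x))^~ (T x) : _ -> R^o) := (inner_bilin H (f x)).2 _.
have E1 u v : inner H (f x) (pnabla2 G H f (cst u) (cst v) T x) (T x) =
    - inner H (f x) (cov u T x) (cov v T x).
  have D1 := cov_metric_cst (smooth_cov oU oU' sH Hpos sf fU v sT) sT
    (fun y => @cov_tension_tension v y) Ux u.
  have D2 : inner H (f x) (cov u (cov v T) x) (T x) =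
      - inner H (f x) (cov u T x) (cov v T x).
    have HC := innerC (Hsym (fU Ux)) (cov u T x) (cov v T x).
    by apply/eqP; rewrite -addr_eq0 HC; apply/eqP.
  have D3 : inner H (f x) (pnabla H f (nabla G (cst u) (cst v)) T x) (T x) = 0.
    rewrite (pnabla_pointwise H f (nabla G (cst u) (cst v)) T x).
    exact: cov_tension_tension.
  apply: etrans (innerDl H (f x) _ _ _) _.
  apply: etrans (congr1 _ (innerNl H (f x) _ _)) _.
  exact: etrans (congr2 (fun p q => p - q) D2 D3) (subr0 _).
have E2 u v : inner H (f x) (riem H (f x) ('D_u f x) (T x) ('D_v f x)) (T x) =
    - (c * t * inner G x u v).
  apply: etrans (riem_constant_curvature oU' sH Hsym Hpos (fU Ux) (curv (fU Ux))
    _ _ _ _) _.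
  rewrite (isom Ux) (T_norm Ux).
  have Tn := tension_normal oU oU' sG Gsym Gpos sH Hsym Hpos sf fU isom.
  by rewrite (Tn v x Ux) mul0r sub0r mulrN -mulrA (mulrC t).
apply: etrans (innerDl H (f x) _ _ _) _.
apply: etrans (congr1 _ (innerNl H (f x) _ _)) _.
apply: etrans (congr2 (fun p q => p - q) (mtrace_map G x _ Il) (mtrace_map G x _ Il)) _.
rewrite /mtrace -sumrB; apply: eq_bigr => i _; rewrite -sumrB; apply: eq_bigr => j _.
rewrite -scalerBr; congr (_ *: _); rewrite E1 E2.
by rewrite opprK addrC.
Qed.

End ConstantTension.

Section SurfaceInSpaceForm.
Context {R : realType}.
Variables (U : set 'rV[R]_2) (U' : set 'rV[R]_3).
Variables (G : 'rV[R]_2 -> 'M[R]_2) (H : 'rV[R]_3 -> 'M[R]_3).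
Variable f : 'rV[R]_2 -> 'rV[R]_3.
Hypotheses (oU : open U) (oU' : open U').
Hypothesis sG : smooth_on U G.
Hypothesis Gsym : forall x, U x -> (G x)^T = G x.
Hypothesis Gpos : forall x, U x -> forall u, u != 0 -> 0 < inner G x u u.
Hypothesis sH : smooth_on U' H.
Hypothesis Hsym : forall y, U' y -> (H y)^T = H y.
Hypothesis Hpos : forall y, U' y -> forall u, u != 0 -> 0 < inner H y u u.
Hypothesis sf : smooth_on U f.
Hypothesis fU : forall x, U x -> U' (f x).
Hypothesis isom : forall x, U x -> forall u v,
  inner H (f x) ('D_u f x) ('D_v f x) = inner G x u v.
Local Notation cov w V := (pnabla H f (cst w) V).
Local Notation T := (tension G H f).
Local Notation hess u v x := (nabla_df G H f (cst u) (cst v) x).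

(** The covariant derivative of D_v f differs from the Hessian of f, which is
    normal, by a tangent vector, and the normal projection kills tangent vectors;
    the latter is read off in an orthogonal frame. *)
Lemma second_form_nabla_df x u v : U x -> second_form G H f x u v = hess u v x.
Proof.
move=> Ux.
pose ff a b := inner H (f x) (pnabla H f (cst u) (push f (cst v)) x) ('D_a f x) *: 'D_b f x.
have [P [Q [P0 Q0 PQ _]]] := simultaneous_diagonalization (Gsym Ux) (Gpos Ux)
  (inner_bilin G x) (innerC (Gsym Ux)).
pose d := Gamma G x u v.
have fl := fd_linear sf Ux.
have E1 a : inner H (f x) (pnabla H f (cst u) (push f (cst v)) x) ('D_a f x) =
    inner G x d a.
  have N := nabla_df_normal oU oU' sG Gsym Gpos sH Hsym Hpos sf fU isom u v a Ux.
  rewrite nabla_dfE in N.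
  have N' := etrans (esym (innerDl H (f x) _ _ _)) N.
  have N2 := etrans (esym (congr1 (fun z => _ + z) (innerNl H (f x) _ _))) N'.
  have N3 := isom Ux d a.
  by apply/eqP; rewrite -subr_eq0 -N3; apply/eqP.
have bff : bilin (fun a b => inner G x d a *: 'D_b f x).
  split=> [a k b b'|b k a a'].
    exact: etrans (congr1 _ (fl k b b')) (etrans (scalerDr _ _ _)
      (congr1 (+%R^~ _) (etrans (scalerA _ _ _) (etrans (congr1 ( *:%R^~ _) (mulrC _ _))
        (esym (scalerA _ _ _)))))).
  apply: etrans (congr1 ( *:%R^~ _) (etrans (innerDr G x d _ _)
    (congr1 (+%R^~ _) (innerZr G x k d a)))) _.
  by rewrite scalerDl scalerA.
have E2 : mtrace G x ff = 'D_d f x.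
  apply: etrans (eq_mtrace G x (b' := fun a b => inner G x d a *: 'D_b f x) _) _.
    by move=> a b; rewrite /ff E1.
  apply: etrans (mtrace_orthogonal_pair (Gsym Ux) (Gpos Ux) bff P0 Q0 PQ) _.
  rewrite [in RHS](orthogonal_pair_expansion (Gsym Ux) (Gpos Ux) P0 Q0 PQ d).
  have fZ := fl (inner G x d Q / inner G x Q Q) Q 0.
  have f0 : 'D_0 f x = 0 := derive0 _ _.
  rewrite f0 !addr0 in fZ.
  apply: etrans _ (esym (fl _ _ _)); rewrite fZ !scalerA.
  by rewrite (mulrC (_ P P)^-1) (mulrC (_ Q Q)^-1).
rewrite nabla_dfE.
exact (congr1 (fun z => pnabla H f (cst u) (push f (cst v)) x - z) E2).
Qed.

Lemma mean_curvature_tension x : U x -> mean_curvature G H f x = 2^-1 *: T x.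
Proof.
move=> Ux; congr (_ *: _); apply: eq_mtrace => u v; exact: second_form_nabla_df.
Qed.

Variables c t : R.
Hypothesis curv : forall y, U' y -> forall u v, free [:: u; v] ->
  sectional_curvature H y u v = c.
Hypothesis T_norm : forall x, U x -> inner H (f x) (T x) (T x) = t.
Hypothesis t_gt0 : 0 < t.
Hypothesis biharm : forall x, U x -> bitension G H f x = 0.

Let sT : smooth_on U T.
Proof. exact: (smooth_tension oU oU' sG Gpos sH Hpos sf fU). Qed.

Let Tn w x : U x -> inner H (f x) (T x) ('D_w f x) = 0.
Proof. exact: (tension_normal oU oU' sG Gsym Gpos sH Hsym Hpos sf fU isom). Qed.

(** Codimension one: the images of an orthogonal frame of the surface together
    with T form an orthogonal basis of the three-dimensional tangent space. *)
Lemma adapted_frame_spans x : U x -> forall u v,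
  u != 0 -> v != 0 -> inner G x u v = 0 -> forall z,
  inner H (f x) z ('D_u f x) = 0 -> inner H (f x) z ('D_v f x) = 0 ->
  inner H (f x) z (T x) = 0 -> z = 0.
Proof.
move=> Ux u v u0 v0 uv z zu zv zT.
have neq0 w : 0 < inner H (f x) w w -> w != 0.
  by apply: contraTneq => ->; rewrite inner0l ltxx.
have P0 w : w != 0 -> 'D_w f x != 0.
  by move=> w0; apply: neq0; rewrite (isom Ux); exact: Gpos.
have T0 : T x != 0 by apply: neq0; rewrite (T_norm Ux).
exact: (orthogonal_triple_eq0 (Hsym (fU Ux)) (Hpos (fU Ux)) (P0 u u0) (P0 v v0) T0
  (etrans (isom Ux u v) uv) (Tn u Ux) (Tn v Ux) zu zv zT).
Qed.

Lemma shape_half_trace : forall x, U x -> forall u w,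
  - inner H (f x) (cov u T x) ('D_w f x) = t / 2 * inner G x u w.
Proof.
have I_linear x w : linear ((inner H (f x))^~ w : _ -> R^o).
  exact: (inner_bilin H (f x)).2.
have I_sym x : U x -> forall u v, inner H (f x) u v = inner H (f x) v u.
  by move=> Ux u v; apply: innerC; exact: Hsym (fU Ux).
have I_pos x : U x -> forall u, u != 0 -> 0 < inner H (f x) u u.
  by move=> Ux; exact: Hpos (fU Ux).
have Sm_D w V : smooth_on U V -> smooth_on U (cov w V).
  by move=> sV; exact: (smooth_cov oU oU' sH Hpos sf fU w sV).
have Sm_comb (k : R) (V W : 'rV[R]_2 -> 'rV[R]_3) : smooth_on U V ->
    smooth_on U W -> smooth_on U (fun x => V x + k *: W x).
  move=> sV sW; apply: (smooth_mxD oU) => //.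
  by apply: (smooth_mxZ oU) => //; exact: smooth_cst.
have D_curvature u v V x : U x -> smooth_on U V -> forall w,
  inner H (f x) (cov u (cov v V) x - cov v (cov u V) x) w =
  c * (inner H (f x) ('D_v f x) (V x) * inner H (f x) ('D_u f x) w
       - inner H (f x) ('D_u f x) (V x) * inner H (f x) ('D_v f x) w).
  move=> Ux sV w.
  apply: etrans (congr1 (fun z => inner H (f x) z w)
    (cov_curvature oU oU' sH Hpos sf fU u v Ux sV)) _.
  exact: (riem_constant_curvature oU' sH Hsym Hpos (fU Ux) (curv (fU Ux))).
have trace_shape x : U x -> forall u v, u != 0 -> v != 0 -> inner G x u v = 0 ->
  - (inner H (f x) (cov u T x) ('D_u f x) / inner G x u u
     + inner H (f x) (cov v T x) ('D_v f x) / inner G x v v) = t.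
  move=> Ux u v u0 v0 uv.
  have bb : bilin (fun u v => - inner H (f x) (cov u T x) ('D_v f x) : R^o).
    have cl := cov_dir_linear H sf Ux sT. have fl := fd_linear sf Ux.
    split=> [a k b b'|b k a a'].
      have E := etrans (congr1 (inner H (f x) (cov a T x)) (fl k b b'))
         ((inner_bilin H (f x)).1 _ _ _ _).
      by apply: etrans (congr1 -%R E) _; rewrite opprD -scalerN.
    have E := etrans (congr1 ((inner H (f x))^~ ('D_b f x)) (cl k a a'))
       ((inner_bilin H (f x)).2 _ _ _ _).
    by apply: etrans (congr1 -%R E) _; rewrite opprD -scalerN.
  have E := inner_tension_tension oU oU' sG Gsym Gpos sH Hsym Hpos sf fU isom Ux.
  have E' := etrans E (mtrace_orthogonal_pair (Gsym Ux) (Gpos Ux) bb u0 v0 uv).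
  have alg (a b p q : R) :
      - (p / a + q / b) = a^-1 *: (- p : R^o) + b^-1 *: (- q : R^o).
    by rewrite /GRing.scale /=; ring.
  exact: etrans (alg _ _ _ _) (etrans (esym E') (T_norm Ux)).
have trace_shape2 x : U x -> forall u v, u != 0 -> v != 0 -> inner G x u v = 0 ->
  inner H (f x) (cov u T x) (cov u T x) / inner G x u u
  + inner H (f x) (cov v T x) (cov v T x) / inner G x v v = 2 * c * t.
  move=> Ux u v u0 v0 uv.
  have bb : bilin (fun u v => c * t * inner G x u v
                         - inner H (f x) (cov u T x) (cov v T x) : R^o).
    have cl := cov_dir_linear H sf Ux sT.
    have alg (k p p' q q' : R) : c * t * (k * p + p') - (k * q + q') =
        k * (c * t * p - q) + (c * t * p' - q') by ring.
    split=> [a k b b'|b k a a'].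
      have E1 := etrans (congr1 (inner H (f x) (cov a T x)) (cl k b b'))
         ((inner_bilin H (f x)).1 _ _ _ _).
      exact: etrans (congr2 (fun p q => c * t * p - q) ((inner_bilin G x).1 a k b b') E1)
        (alg _ _ _ _ _).
    have E1 := etrans (congr1 ((inner H (f x))^~ (cov b T x)) (cl k a a'))
       ((inner_bilin H (f x)).2 _ _ _ _).
    exact: etrans (congr2 (fun p q => c * t * p - q) ((inner_bilin G x).2 b k a a') E1)
      (alg _ _ _ _ _).
  have E1 := inner_bitension_tension oU oU' sG Gsym Gpos sH Hsym Hpos sf fU isom
    curv T_norm Ux.
  have E2 := etrans E1 (mtrace_orthogonal_pair (Gsym Ux) (Gpos Ux) bb u0 v0 uv).
  have E3 := etrans (esym (congr1 ((inner H (f x))^~ (T x)) (biharm Ux))) E2.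
  have {E1 E2}E3 := etrans (esym (inner0l H (f x) (T x))) E3.
  have alg (a b p q : R) : 0 < a -> 0 < b ->
      0 = a^-1 *: (c * t * a - p : R^o) + b^-1 *: (c * t * b - q : R^o) ->
      p / a + q / b = 2 * c * t.
    rewrite /GRing.scale /= => a0 b0 E.
    apply/eqP; rewrite -subr_eq0; apply/eqP; rewrite -oppr0 [in RHS]E.
    by field; rewrite !gt_eqF.
  exact: alg _ _ _ _ (Gpos Ux u0) (Gpos Ux v0) E3.
exact (@shape_half_trace_of_traces R _ U G (fun x => inner H (f x)) (smooth_on U)
  (fun w V => cov w V) (fun w x => 'D_w f x) T c t Gsym Gpos I_linear I_sym I_pos
  Sm_D Sm_comb (fun w => smooth_derive w sf) sT
  (fun w k V W x Ux => @cov_comb _ _ _ U H f oU w k V W x Ux)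
  (fun V x Ux sV => cov_dir_linear H sf Ux sV) (fun x Ux => fd_linear sf Ux)
  (cov_metric_cst oU oU' sH Hsym Hpos sf fU)
  (fun u v x Ux => cov_torsion oU oU' Hsym sf fU u v Ux)
  D_curvature isom (fun x Ux w => Tn w Ux) T_norm t_gt0 adapted_frame_spans
  trace_shape trace_shape2).
Qed.

Theorem local_umbilical x : U x -> forall u v,
  second_form G H f x u v = inner G x u v *: mean_curvature G H f x.
Proof.
move=> Ux u v; rewrite second_form_nabla_df // mean_curvature_tension //.
have [P [Q [P0 Q0 PQ _]]] := simultaneous_diagonalization (Gsym Ux) (Gpos Ux)
  (inner_bilin G x) (innerC (Gsym Ux)).
have HN w : inner H (f x) (hess u v x) ('D_w f x) = 0.
  exact: (nabla_df_normal oU oU' sG Gsym Gpos sH Hsym Hpos sf fU isom).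
have HT : inner H (f x) (hess u v x) (T x) = t / 2 * inner G x u v.
  apply: etrans (innerC (Hsym (fU Ux)) _ _) _.
  apply: etrans (inner_tension_nabla_df oU oU' sG Gsym Gpos sH Hsym Hpos sf fU isom u v Ux) _.
  exact: shape_half_trace.
have TN w := Tn w Ux; have TT := T_norm Ux.
apply/subr0_eq/(adapted_frame_spans Ux P0 Q0 PQ).
- apply: etrans (innerDl H (f x) _ _ _) _.
  by rewrite innerNl !innerZl HN TN !mulr0 subr0.
- apply: etrans (innerDl H (f x) _ _ _) _.
  by rewrite innerNl !innerZl HN TN !mulr0 subr0.
apply: etrans (innerDl H (f x) _ _ _) _.
by rewrite innerNl !innerZl HT TT; field.
Qed.
End SurfaceInSpaceForm.

(** * From charts to manifolds *)

Section ChartDomains.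
Context {R : realType} {m n : nat}.
Variables (M : manifold R m) (N : manifold R n) (phi : M -> N).

(** The set is the preimage, under the parametrization of the chart, of an open
    subset of the manifold. *)
Lemma local_domain_open (i : chart M) (j : chart N) : continuous phi ->
  open (coord i @` (dom i `&` phi @^-1` dom j)).
Proof.
move=> cphi.
have oA := @image_open R m M i.
have oW : open (phi @^-1` dom j) by move/continuousP: cphi; apply; exact: dom_open.
rewrite openE => _ [p [ip jp] <-].
have pA : (coord i @` dom i) (coord i p) by exists p.
have := @param_continuous R m M i; rewrite continuous_open_subspace //.
move=> /(_ (coord i p)); rewrite inE => /(_ pA).
rewrite /continuous_at /= coordK // => /(_ (phi @^-1` dom j)).
move=> /(_ (open_nbhs_nbhs (conj oW jp))) nW.
have nA : nbhs (coord i p) (coord i @` dom i) by exact: open_nbhs_nbhs.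
apply: filterS2 nA nW => x [q qi <-] /=; rewrite coordK // => qj.
by exists q.
Qed.

Lemma local_rep_coord (i : chart M) (j : chart N) p : dom i p ->
  local_rep phi i j (coord i p) = coord j (phi p).
Proof. by move=> ip; rewrite /local_rep /= coordK. Qed.

End ChartDomains.

Section ImmersedSurface.
Context {R : realType}.
Variables (M : manifold R 2) (g : metric M) (N : manifold R 3) (h : metric N).
Variable phi : M -> N.
Hypothesis imm : riemannian_immersion g h phi.
Variables (i : chart M) (j : chart N).
Local Notation U := (coord i @` (dom i `&` phi @^-1` dom j)).
Local Notation U' := (coord j @` dom j).
Local Notation f := (local_rep phi i j).

Let oU : open U. Proof. by case: imm => -[cphi _] _ _; exact: local_domain_open. Qed.
Let oU' : open U'. Proof. exact: image_open. Qed.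
Let sG : smooth_on U (g i).
Proof.
by apply: smooth_on_sub (@gmx_smooth _ _ _ g i) => _ [p [ip _] <-]; exists p.
Qed.
Let Gsym x : U x -> (g i x)^T = g i x.
Proof. by move=> [p [ip _] <-]; exact: gmx_sym. Qed.
Let Gpos x : U x -> forall u, u != 0 -> 0 < inner (g i) x u u.
Proof. by move=> [p [ip _] <-]; exact: gmx_pos. Qed.
Let sH : smooth_on U' (h j). Proof. exact: gmx_smooth. Qed.
Let Hsym y : U' y -> (h j y)^T = h j y.
Proof. by move=> [p jp <-]; exact: gmx_sym. Qed.
Let Hpos y : U' y -> forall u, u != 0 -> 0 < inner (h j) y u u.
Proof. by move=> [p jp <-]; exact: gmx_pos. Qed.
Let sf : smooth_on U f. Proof. by case: imm => -[_ sphi] _ _; exact: sphi. Qed.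
Let fU x : U x -> U' (f x).
Proof. by move=> [p [ip jp] <-]; exists (phi p) => //; rewrite local_rep_coord. Qed.
Let isom x : U x -> forall u v,
  inner (h j) (f x) ('D_u f x) ('D_v f x) = inner (g i) x u v.
Proof. by case: imm => _ _ iso [p [ip jp] <-]; exact: iso. Qed.

Lemma chart_mean_curvature_tension p : dom i p -> dom j (phi p) ->
  mean_curvature (g i) (h j) f (coord i p) =
  2^-1 *: tension (g i) (h j) f (coord i p).
Proof.
move=> ip jp.
have Up : U (coord i p) by exists p.
exact: (mean_curvature_tension oU oU' sG Gsym Gpos sH Hsym Hpos sf fU isom Up).
Qed.

(** The tension field is twice the mean curvature vector field. *)
Lemma chart_tension_norm p : dom i p -> dom j (phi p) ->
  inner (h j) (f (coord i p)) (tension (g i) (h j) f (coord i p))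
    (tension (g i) (h j) f (coord i p)) =
  4 * mean_curvature_norm (g i) (h j) f (coord i p) ^+ 2.
Proof.
move=> ip jp.
have Up : U (coord i p) by exists p.
have M0 := inner_ge0 (Hpos (fU Up)) (mean_curvature (g i) (h j) f (coord i p)).
apply: etrans _ (congr1 ( *%R 4) (esym (sqr_sqrtr M0))).
rewrite chart_mean_curvature_tension //.
move: (tension _ _ _ _) => T; rewrite innerZl innerZr; by field.
Qed.

Lemma chart_tension_pos p : dom i p -> dom j (phi p) ->
  tension (g i) (h j) f (coord i p) <> 0 ->
  mean_curvature_norm (g i) (h j) f (coord i p) != 0.
Proof.
move=> ip jp /eqP T0.
have Up : U (coord i p) by exists p.
have := Hpos (fU Up) T0; rewrite chart_tension_norm //.
by apply: contraTneq => ->; rewrite expr0n mulr0 ltxx.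
Qed.

Lemma chart_umbilical (c k : R) p : dom i p -> dom j (phi p) ->
  constant_curvature h c -> biharmonic g h phi -> k != 0 ->
  (forall q, dom i q -> dom j (phi q) ->
     mean_curvature_norm (g i) (h j) f (coord i q) = k) ->
  forall u v, second_form (g i) (h j) f (coord i p) u v =
    inner (g i) (coord i p) u v *: mean_curvature (g i) (h j) f (coord i p).
Proof.
move=> ip jp curv biharm k0 Hk.
have Up : U (coord i p) by exists p.
have curv' y : U' y -> forall u v, free [:: u; v] ->
    sectional_curvature (h j) y u v = c.
  by move=> [q qj <-]; exact: curv.
have T_norm x : U x -> inner (h j) (f x) (tension (g i) (h j) f x)
    (tension (g i) (h j) f x) = 4 * k ^+ 2.
  by move=> [q [qi qj] <-]; rewrite chart_tension_norm // Hk.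
have t0 : 0 < 4 * k ^+ 2 by rewrite mulr_gt0 // exprn_even_gt0.
have biharm' x : U x -> bitension (g i) (h j) f x = 0.
  by move=> [q [qi qj] <-]; exact: biharm.
exact: (local_umbilical oU oU' sG Gsym Gpos sH Hsym Hpos sf fU isom curv' T_norm t0
  biharm' Up).
Qed.

End ImmersedSurface.

Theorem corollary5 (R : realType) (M : manifold R 2) (g : metric M)
    (N : manifold R 3) (h : metric N) (c : R) (phi : M -> N) :
  constant_curvature h c ->
  riemannian_immersion g h phi ->
  proper_biharmonic g h phi ->
  constant_mean_curvature g h phi ->
  umbilical g h phi.
Proof.
move=> curv imm [biharm nharm] [k Hk].
have k0 : k != 0.
  apply/eqP => k0; apply: nharm => i j p ip jp.
  apply: contra_notP (chart_tension_pos imm ip jp) _.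
  by rewrite Hk // k0 eqxx.
move=> i j p ip jp.
by apply: (chart_umbilical imm ip jp curv biharm k0) => q; exact: Hk.
Qed.
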